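(* Let $B=\mathcal{O}_q(S^2)$, with the differential graded algebra $(\Omega(B),d)$, the hom-connection $\nabla^{coH}:\Omega^1(B)^*\to B$ and the maps $\Theta^*:B\to\Omega^2(B)^*$, $\Psi:\Omega^1(B)\to\Omega^1(B)^*$, $\Theta:B\to\Omega^2(B)$ described in the context. The diagram with top row $$B\xrightarrow{d}\Omega^1(B)\xrightarrow{d}\Omega^2(B),$$ bottom row $$\Omega^2(B)^*\xrightarrow{\nabla_1^{coH}}\Omega^1(B)^*\xrightarrow{\nabla^{coH}}B,$$ and columns $\Theta^*:B\to\Omega^2(B)^*$, $\Psi:\Omega^1(B)\to\Omega^1(B)^*$, $\Theta:B\to\Omega^2(B)$ (the last one directed upwards), is commutative, i.e. $\Psi\circ d=\nabla_1^{coH}\circ\Theta^*$ and $d=\Theta\circ\nabla^{coH}\circ\Psi$, and all the columns are $B$-bimodule isomorphisms. Consequently, the integral complex associated to $\nabla^{coH}$ is isomorphic to the de Rham complex.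
   Context: $k$ is a field of characteristic $0$ and $q\in k$ is non-zero and not a root of unity. $A=\mathcal{O}_q(SL(2))$ is the $k$-algebra generated by $\alpha,\beta,\gamma,\delta$ with relations $\alpha\beta=q\beta\alpha$, $\alpha\gamma=q\gamma\alpha$, $\beta\gamma=\gamma\beta$, $\beta\delta=q\delta\beta$, $\gamma\delta=q\delta\gamma$, $\alpha\delta=\delta\alpha+(q-q^{-1})\beta\gamma$, $\alpha\delta-q\beta\gamma=1$, $\mathbb{Z}$-graded by $|\alpha|=|\gamma|=1$, $|\beta|=|\delta|=-1$. $B=\mathcal{O}_q(S^2)$ is its degree zero subalgebra, generated by $\alpha\beta,\gamma\delta,\beta\gamma$. 3D calculus on $A$: let $\sigma_0(a)=q^{-2|a|}a$, $\sigma_\pm(a)=q^{-|a|}a$ for homogeneous $a$, and let $\partial_i:A\to A$, $i\in\{0,+,-\}$, be the $k$-linear maps with $\partial_i(ab)=\partial_i(a)\sigma_i(b)+a\partial_i(b)$ and $\partial_0(\alpha)=\alpha$, $\partial_0(\beta)=-q^2\beta$, $\partial_0(\gamma)=\gamma$, $\partial_0(\delta)=-q^2\delta$; $\partial_+(\alpha)=-q\beta$, $\partial_+(\gamma)=-q\delta$, $\partial_+(\beta)=\partial_+(\delta)=0$; $\partial_-(\beta)=\alpha$, $\partial_-(\delta)=\gamma$, $\partial_-(\alpha)=\partial_-(\gamma)=0$. $\Omega^1(A)$ is free as a left (and right) $A$-module on $\omega_0,\omega_+,\omega_-$ with $\omega_ia=\sigma_i(a)\omega_i$, and $da=\sum_i\partial_i(a)\omega_i$.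 Higher forms: $\omega_i^2=0$, $\omega_+\omega_-=-q^2\omega_-\omega_+$, $\omega_0\omega_-=-q^4\omega_-\omega_0$, $\omega_+\omega_0=-q^4\omega_0\omega_+$; $d\omega_0=q\omega_-\omega_+$, $d\omega_+=q^2(q^2+1)\omega_0\omega_+$, $d\omega_-=q^2(q^2+1)\omega_-\omega_0$. Calculus on $B$: $\Omega(B)=B\oplus\Omega^1(B)\oplus\Omega^2(B)$ is obtained by restriction. $\Omega^1(B)$ is the $B$-bimodule generated by $d(B)$, i.e. by $\alpha^2\omega_-,\alpha\gamma\omega_-,\gamma^2\omega_-,\beta^2\omega_+,\beta\delta\omega_+,\delta^2\omega_+$; its elements are $x\omega_-+y\omega_+$ with $x,y\in A$ of degrees $|x|=2$, $|y|=-2$. $\Omega^2(B)$ is freely generated over $B$ by the central element $\omega_+\omega_-=-q^2\omega_-\omega_+$, and $d(x\omega_-+y\omega_+)=(\partial_+(x)-q^{-2}\partial_-(y))\omega_+\omega_-$. Notation: $\Omega^n(B)^*=\mathrm{Hom}_B(\Omega^n(B),B)$ (right $B$-module maps), with $(fb)(\omega)=f(b\omega)$, $(bf)(\omega)=bf(\omega)$. The hom-connection is $$\nabla^{coH}(f)=q^{-2}\partial_+(\widehat f(\omega_+))+q^2\partial_-(\widehat f(\omega_-)),$$ where $\widehat f:\Omega^1(B)A=\omega_-A\oplus\omega_+A\to A$ is the unique right $A$-linear extension of $f\in\Omega^1(B)^*$. It satisfies $\nabla^{coH}(fb)=\nabla^{coH}(f)b+f(db)$. Further, $\nabla_1^{coH}:\Omega^2(B)^*\to\Omega^1(B)^*$,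 $\nabla^{coH}_1(f)(\omega)=\nabla^{coH}(f\omega)+f(d\omega)$, where $(f\omega)(\omega')=f(\omega\omega')$. The integral complex associated to $\nabla^{coH}$ is the bottom row of the diagram; the de Rham complex is the top row. Maps: $\Theta(b)=\omega_-\omega_+b$. $\Theta^*(b)=\phi b$, where $\phi:\Omega^2(B)\to B$ is the right $B$-linear map with $\phi(\omega_-\omega_+)=1$. To define $\Psi$, put $\mathsf b_1=\alpha^2$, $\mathsf b_2=\gamma^2$, $\mathsf b_3=\alpha\gamma$, $\mathsf a_1=\delta^2$, $\mathsf a_2=q^2\beta^2$, $\mathsf a_3=-(q+q^{-1})\beta\delta$, $q_1=1$, $q_2=q^{-4}$, $q_3=q^{-2}$ (so $\sum_i\mathsf b_i\mathsf a_i=\sum_iq_i\mathsf a_i\mathsf b_i=1$). Then $\Omega^1(B)=\Gamma_+\oplus\Gamma_-$, with $\Gamma_+$ generated by $\mathsf w_i=\omega_+\mathsf a_i$ and $\Gamma_-$ generated by $\mathsf u_i=\omega_-\mathsf b_i$, $i=1,2,3$; these are finitely generated projective right $B$-modules with dual bases $\mathsf w_i^*\in\Gamma_+^*=\mathrm{Hom}_B(\Gamma_+,B)$, $\mathsf u_i^*\in\Gamma_-^*=\mathrm{Hom}_B(\Gamma_-,B)$ given by $\mathsf w_i^*(\mathsf w_j)=q_i\mathsf b_i\mathsf a_j$, $\mathsf u_i^*(\mathsf u_j)=\mathsf a_i\mathsf b_j$. Put $\Psi_+:\Gamma_+\to\Gamma_-^*$, $\Psi_+(\mathsf w)=\sum_i\mathsf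 u_i^*\mathsf w_i^*(\mathsf w)$, and $\Psi_-:\Gamma_-\to\Gamma_+^*$, $\Psi_-(\mathsf u)=\sum_iq_i^{-1}\mathsf w_i^*\mathsf u_i^*(\mathsf u)$. (In these two sums the expressions are read as follows: $\Psi_+(\mathsf w)(\mathsf u)=\sum_i \mathsf u_i^*(\mathsf w')$-type products are formed with the values computed in $A$, so that explicitly $\Psi_+(\omega_+y)(\omega_-x)=yx$ and $\Psi_-(\omega_-x)(\omega_+y)=xy$ for $x,y\in A$ with $|x|=2$, $|y|=-2$.) Finally $\Psi=\Psi_+-q^2\Psi_-:\Gamma_+\oplus\Gamma_-=\Omega^1(B)\to\Omega^1(B)^*=\Gamma_-^*\oplus\Gamma_+^*$. *)

(* Defs.v *)
From HB Require Import structures.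
From mathcomp Require Import all_boot all_order all_algebra ring.
From mathcomp Require Import boolp classical_sets functions.

Set Implicit Arguments.
Unset Strict Implicit.
Unset Printing Implicit Defensive.

Import GRing.Theory.
Local Open Scope ring_scope.

Reserved Notation "u *< a" (at level 40, left associativity).

(* ------------------------- Bimodules and duals ------------------------- *)

HB.mixin Record Lmodule_isBimodule (R : nzRingType) M of GRing.Lmodule R M := {
  rscale : M -> R -> M;
  rscale1 : forall u, rscale u 1 = u;
  rscaleA : forall u a b, rscale u (a * b) = rscale (rscale u a) b;
  rscaleDl : forall u v a, rscale (u + v) a = rscale u a + rscale v a;
  rscaleDr : forall u a b, rscale u (a + b) = rscale u a + rscale u b;
  scale_rscale : forall a u b, rscale (a *: u) b = a *: rscale u b
}.
#[short(type="bimodType")]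
HB.structure Definition Bimodule (R : nzRingType) :=
  {M of GRing.Lmodule R M & Lmodule_isBimodule R M}.

Notation "u *< a" := (rscale u a) : ring_scope.

HB.instance Definition _ (R : nzRingType) :=
  @Lmodule_isBimodule.Build R R^o (fun u a : R => u * a) (@mulr1 R) (@mulrA R)
    (@mulrDl R) (@mulrDr R) (fun a u b => esym (mulrA a u b)).

Section BimoduleTheory.
Variables (R : nzRingType) (M N : bimodType R).

Lemma rscale0l (a : R) : (0 : M) *< a = 0.
Proof. by apply: (addrI ((0 : M) *< a)); rewrite -rscaleDl !addr0. Qed.

Lemma rscaleNl (u : M) (a : R) : (- u) *< a = - (u *< a).
Proof. by apply: (addrI (u *< a)); rewrite -rscaleDl !subrr rscale0l. Qed.

Lemma rscale_sum n (u : 'I_n -> M) (a : R) :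
  (\sum_i u i) *< a = \sum_i u i *< a.
Proof. by elim/big_rec2: _ => [|i x y _ <-]; rewrite ?rscale0l ?rscaleDl. Qed.

Definition bimod_morphism (f : M -> N) :=
  [/\ forall u v, f (u + v) = f u + f v,
      forall b u, f (b *: u) = b *: f u
    & forall u b, f (u *< b) = f u *< b].

Definition bimod_iso (f : M -> N) := bimod_morphism f /\ bijective f.

Definition rlinear (f : M -> R) :=
  (forall u v, f (u + v) = f u + f v) /\ (forall u b, f (u *< b) = f u * b).

Definition rlinear_pred : {pred M -> R} := fun f => `[< rlinear f >].

Fact rlinear_zmod : zmod_closed rlinear_pred.
Proof.
split; first by apply/asboolP; split=> [u v|u b]; rewrite /= ?addr0 ?mul0r.
move=> f g /asboolP[fD fM] /asboolP[gD gM]; apply/asboolP; split=> [u v|u b].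
  by rewrite !fctE fD gD opprD addrACA.
by rewrite !fctE fM gM mulrBl.
Qed.
HB.instance Definition _ := GRing.isZmodClosed.Build _ rlinear_pred rlinear_zmod.

(* Hom_R(M, R), for right R-linear maps *)
Definition rdual := {f : M -> R | f \in rlinear_pred}.
HB.instance Definition _ := [isSub of rdual for sval].
HB.instance Definition _ := [Choice of rdual by <:].
HB.instance Definition _ := [SubChoice_isSubZmodule of rdual by <:].

Definition rdual_fun (f : rdual) : M -> R := sval f.
Coercion rdual_fun : rdual >-> Funclass.

Definition mk_rdual (f : M -> R) (fP : rlinear f) : rdual :=
  exist _ f (introT (asboolP _) fP).

Lemma rdualP (f : rdual) : rlinear f.
Proof. by apply/asboolP; exact: (svalP f). Qed.

Lemma rdualD_eq (f : rdual) u v : f (u + v) = f u + f v.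
Proof. by case: (rdualP f). Qed.

Lemma rdualM_eq (f : rdual) u b : f (u *< b) = f u * b.
Proof. by case: (rdualP f). Qed.

Lemma rdual_sum (f : rdual) n (u : 'I_n -> M) :
  f (\sum_i u i) = \sum_i f (u i).
Proof.
apply: (big_morph f); first exact: rdualD_eq.
by apply: (addrI (f 0)); rewrite -rdualD_eq !addr0.
Qed.

Lemma rdual_ext (f g : rdual) : f =1 g -> f = g.
Proof. by move=> fg; apply/val_inj/funext. Qed.

Lemma rdual_addE (f g : rdual) u : (f + g : rdual) u = f u + g u.
Proof. by []. Qed.

Lemma rdual_scale_subproof (b : R) (f : rdual) :
  rlinear (fun u => b * f u).
Proof. by split=> [u v|u c]; rewrite ?rdualD_eq ?rdualM_eq ?mulrDr ?mulrA. Qed.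
Definition rdual_scale b f := mk_rdual (rdual_scale_subproof b f).

Fact rdual_scaleA a b f :
  rdual_scale a (rdual_scale b f) = rdual_scale (a * b) f.
Proof. by apply: rdual_ext => u /=; rewrite /rdual_fun /= mulrA. Qed.
Fact rdual_scale1 : left_id 1 rdual_scale.
Proof. by move=> f; apply: rdual_ext => u; rewrite /rdual_fun /= mul1r. Qed.
Fact rdual_scaleDr : right_distributive rdual_scale +%R.
Proof. by move=> a f g; apply: rdual_ext => u; rewrite /rdual_fun /= mulrDr. Qed.
Fact rdual_scaleDl f : {morph rdual_scale^~ f : a b / a + b}.
Proof. by move=> a b; apply: rdual_ext => u; rewrite /rdual_fun /= mulrDl. Qed.
HB.instance Definition _ := GRing.Zmodule_isLmodule.Build R rdual
  rdual_scaleA rdual_scale1 rdual_scaleDr rdual_scaleDl.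

Lemma rdual_rscale_subproof (f : rdual) (b : R) : rlinear (fun u => f (b *: u)).
Proof.
by split=> [u v|u c]; rewrite ?scalerDr ?rdualD_eq // -scale_rscale rdualM_eq.
Qed.
Definition rdual_rscale f b := mk_rdual (rdual_rscale_subproof f b).

Fact rdual_rscale1 f : rdual_rscale f 1 = f.
Proof. by apply: rdual_ext => u; rewrite /rdual_fun /= scale1r. Qed.
Fact rdual_rscaleA f a b :
  rdual_rscale f (a * b) = rdual_rscale (rdual_rscale f a) b.
Proof. by apply: rdual_ext => u; rewrite /rdual_fun /= scalerA. Qed.
Fact rdual_rscaleDl f g a :
  rdual_rscale (f + g) a = rdual_rscale f a + rdual_rscale g a.
Proof. by apply: rdual_ext. Qed.
Fact rdual_rscaleDr f a b :
  rdual_rscale f (a + b) = rdual_rscale f a + rdual_rscale f b.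
Proof.
by apply: rdual_ext => u; rewrite rdual_addE /rdual_fun /= scalerDl rdualD_eq.
Qed.
Fact rdual_scale_rscale a f b :
  rdual_rscale (a *: f) b = a *: rdual_rscale f b.
Proof. by apply: rdual_ext. Qed.
HB.instance Definition _ := Lmodule_isBimodule.Build R rdual
  rdual_rscale1 rdual_rscaleA rdual_rscaleDl rdual_rscaleDr rdual_scale_rscale.

Lemma rdual_lE (b : R) (f : rdual) u : (b *: f : rdual) u = b * f u.
Proof. by []. Qed.
Lemma rdual_rE (f : rdual) (b : R) u : (f *< b : rdual) u = f (b *: u).
Proof. by []. Qed.

End BimoduleTheory.

(* Complexes of bimodules over a k-algebra, with k-linear differentials. *)
Section Complexes.
Variables (k : nzRingType) (R : algType k).

Definition klinear (M N : bimodType R) (f : M -> N) :=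
  forall (c : k) u v, f (c%:A *: u + v) = c%:A *: f u + f v.

Definition is_complex (M0 M1 M2 : bimodType R) (d0 : M0 -> M1) (d1 : M1 -> M2) :=
  [/\ klinear d0, klinear d1 & forall u, d1 (d0 u) = 0].

Definition complexes_isomorphic (M0 M1 M2 N0 N1 N2 : bimodType R)
    (d0 : M0 -> M1) (d1 : M1 -> M2) (e0 : N0 -> N1) (e1 : N1 -> N2) :=
  [/\ is_complex d0 d1, is_complex e0 e1 &
    exists f0 : M0 -> N0, exists f1 : M1 -> N1, exists f2 : M2 -> N2,
      [/\ bimod_iso f0, bimod_iso f1, bimod_iso f2,
          forall u, f1 (d0 u) = e0 (f0 u) & forall u, f2 (d1 u) = e1 (f1 u)]].
End Complexes.

(* ------------------------------ O_q(SL(2)) ------------------------------ *)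

Definition nonzero_not_root_of_unity (k : fieldType) (q : k) :=
  q != 0 /\ forall n : nat, (0 < n)%N -> q ^+ n != 1.

Definition SL2_relations (k : fieldType) (q : k) (A : algType k)
    (a b c d : A) : Prop :=
  [/\ a * b = q *: (b * a),
      a * c = q *: (c * a),
      b * c = c * b,
      b * d = q *: (d * b)
    & c * d = q *: (d * c)] /\
  (a * d = d * a + (q - q^-1) *: (b * c) /\ a * d - q *: (b * c) = 1).

(* The k-algebra presented by the generators alpha, ..., delta and the
   relations above, given by its universal property (uniqueness of the
   morphism in the last field follows from Oq_generated). *)
Record OqSL2 (k : fieldType) (q : k) := {
  Oq_alg :> algType k;
  alpha : Oq_alg;
  beta : Oq_alg;
  gamma : Oq_alg;
  delta : Oq_alg;
  Oq_relations : SL2_relations q alpha beta gamma delta;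
  Oq_generated : forall P : Oq_alg -> Prop,
    (forall c : k, P c%:A) ->
    (forall x y, P x -> P y -> P (x + y)) ->
    (forall x y, P x -> P y -> P (x * y)) ->
    P alpha -> P beta -> P gamma -> P delta -> forall x, P x;
  Oq_universal : forall (A' : algType k) (a b c d : A'),
    SL2_relations q a b c d ->
    exists f : {lrmorphism Oq_alg -> A'},
      [/\ f alpha = a, f beta = b, f gamma = c & f delta = d]
}.
Arguments alpha {k q A} : rename.
Arguments beta {k q A} : rename.
Arguments gamma {k q A} : rename.
Arguments delta {k q A} : rename.

Section Grading.
Variables (k : fieldType) (q : k) (A : OqSL2 q).

(* homog n x : x lies in the homogeneous component of degree n *)
Inductive homog : int -> A -> Prop :=
| homog0 n : homog n 0
| homog1 : homog 0 1
| homog_alpha : homog 1 alpha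
| homog_beta : homog (-1) beta
| homog_gamma : homog 1 gamma
| homog_delta : homog (-1) delta
| homogD n x y : homog n x -> homog n y -> homog n (x + y)
| homogZ n c x : homog n x -> homog n (c *: x)
| homogM m n x y : homog m x -> homog n y -> homog (m + n) (x * y).

Lemma homogN n x : homog n x -> homog n (- x).
Proof. by rewrite -scaleN1r; exact: homogZ. Qed.

Lemma homogMe m n p x y : homog m x -> homog n y -> m + n = p -> homog p (x * y).
Proof. by move=> hx hy <-; exact: homogM. Qed.

Lemma homog_sum n m (x : 'I_m -> A) :
  (forall i, homog n (x i)) -> homog n (\sum_i x i).
Proof. by move=> h; apply: big_ind => //; [exact: homog0 | exact: homogD]. Qed.

Lemma homog_span (P : A -> Prop) :
  (forall n x, homog n x -> P x) -> (forall x y, P x -> P y -> P (x + y)) ->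
  forall x, P x.
Proof.
move=> hP PD x; move: x P hP PD.
apply: (@Oq_generated _ _ A) => [c|x y Hx Hy|x y Hx Hy| | | |] P hP PD.
- by apply: (hP 0); apply: homogZ; exact: homog1.
- exact: PD (Hx P hP PD) (Hy P hP PD).
- apply: (Hx (fun x => P (x * y))) => [m x' hx|x1 x2 P1 P2]; last first.
    by rewrite mulrDl; exact: PD.
  apply: (Hy (fun y => P (x' * y))) => [n y' hy|y1 y2 P1 P2]; last first.
    by rewrite mulrDr; exact: PD.
  by apply: (hP (m + n)); exact: homogM.
- exact: (hP _ _ homog_alpha).
- exact: (hP _ _ homog_beta).
- exact: (hP _ _ homog_gamma).
- exact: (hP _ _ homog_delta).
Qed.

Definition degree0 : {pred A} := fun x => `[< homog 0 x >].

Fact degree0_subalg : GRing.subalg_closed degree0.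
Proof.
split; first by apply/asboolP; exact: homog1.
  move=> c x y /asboolP hx /asboolP hy; apply/asboolP.
  by apply: homogD => //; exact: homogZ.
by move=> x y /asboolP hx /asboolP hy; apply/asboolP; apply: homogMe hx hy _.
Qed.
HB.instance Definition _ := GRing.isSubalgClosed.Build k A degree0 degree0_subalg.

Definition OqS2 := {x : A | x \in degree0}.
HB.instance Definition _ := [isSub of OqS2 for sval].
HB.instance Definition _ := [Choice of OqS2 by <:].
HB.instance Definition _ := [SubChoice_isSubAlgebra of OqS2 by <:].

Definition mkB x (hx : homog 0 x) : OqS2 := exist _ x (introT (asboolP _) hx).

Lemma val_OqS2_sum n (u : 'I_n -> OqS2) : val (\sum_i u i) = \sum_i val (u i).
Proof. exact: (big_morph val). Qed.

Lemma OqS2_homog (b : OqS2) : homog 0 (val b).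
Proof. by apply/asboolP; exact: (valP b). Qed.

End Grading.

Section AlgebraFacts.
Variables (k : fieldType) (q : k) (hq : nonzero_not_root_of_unity q).
Variable (A : OqSL2 q).
Local Notation a := (@alpha k q A).
Local Notation b := (@beta k q A).
Local Notation c := (@gamma k q A).
Local Notation d := (@delta k q A).
Let q0 : q != 0. Proof. by case: hq. Qed.

Lemma ab_rel : a * b = q *: (b * a).
Proof. by case: (Oq_relations A) => [[]]. Qed.
Lemma ac_rel : a * c = q *: (c * a).
Proof. by case: (Oq_relations A) => [[]]. Qed.
Lemma bc_rel : b * c = c * b.
Proof. by case: (Oq_relations A) => [[]]. Qed.
Lemma bd_rel : b * d = q *: (d * b).
Proof. by case: (Oq_relations A) => [[]]. Qed.
Lemma cd_rel : c * d = q *: (d * c).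
Proof. by case: (Oq_relations A) => [[]]. Qed.
Lemma ad_rel : a * d = 1 + q *: (b * c).
Proof. by case: (Oq_relations A) => _ [_] <-; rewrite subrK. Qed.
Lemma da_rel : d * a = 1 + q^-1 *: (b * c).
Proof.
case: (Oq_relations A) => _ [h _]; move: h; rewrite ad_rel scalerBl => h.
apply: (addIr (q *: (b * c) - q^-1 *: (b * c))); rewrite -h.
by rewrite -addrA [X in _ = _ + X]addrC subrK.
Qed.
Lemma ba_rel : b * a = q^-1 *: (a * b).
Proof. by rewrite ab_rel scalerA mulVf // scale1r. Qed.
Lemma ca_rel : c * a = q^-1 *: (a * c).
Proof. by rewrite ac_rel scalerA mulVf // scale1r. Qed.
Lemma db_rel : d * b = q^-1 *: (b * d).
Proof. by rewrite bd_rel scalerA mulVf // scale1r. Qed.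
Lemma dc_rel : d * c = q^-1 *: (c * d).
Proof. by rewrite cd_rel scalerA mulVf // scale1r. Qed.


(* Normal ordering: powers of beta, then of gamma, then of alpha or delta. *)
Let zAl (e : k) (x y : A) : (e *: x) * y = e *: (x * y).
Proof. by rewrite scalerAl. Qed.
Let zAr (e : k) (x y : A) : x * (e *: y) = e *: (x * y).
Proof. by rewrite scalerAr. Qed.
Let zA (e e' : k) (x : A) : e *: (e' *: x) = (e * e') *: x.
Proof. exact: scalerA. Qed.
Let cb : c * b = b * c. Proof. by rewrite bc_rel. Qed.
Let ab' x : x * a * b = q *: (x * b * a).
Proof. by rewrite -mulrA ab_rel zAr mulrA. Qed.
Let ac' x : x * a * c = q *: (x * c * a).
Proof. by rewrite -mulrA ac_rel zAr mulrA. Qed.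
Let db' x : x * d * b = q^-1 *: (x * b * d).
Proof. by rewrite -mulrA db_rel zAr mulrA. Qed.
Let dc' x : x * d * c = q^-1 *: (x * c * d).
Proof. by rewrite -mulrA dc_rel zAr mulrA. Qed.
Let cb' x : x * c * b = x * b * c.
Proof. by rewrite -mulrA cb mulrA. Qed.
Let ad' x : x * a * d = x + q *: (x * b * c).
Proof. by rewrite -mulrA ad_rel mulrDr mulr1 zAr mulrA. Qed.
Let da' x : x * d * a = x + q^-1 *: (x * b * c).
Proof. by rewrite -mulrA da_rel mulrDr mulr1 zAr mulrA. Qed.
Definition nc_rules :=
  (mulrA, zAl, zAr, zA, (@mulrDl A), (@mulrDr A), (@scalerDr k A), cb, cb',
   ab_rel, ab', ac_rel, ac', db_rel, db', dc_rel, dc', ad_rel, ad', da_rel, da',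
   mul1r, mulr1).

Definition sfb (i : 'I_3) : A := [:: a ^+ 2; c ^+ 2; a * c]`_i.
Definition sfa (i : 'I_3) : A :=
  [:: d ^+ 2; q ^+ 2 *: b ^+ 2; - (q + q^-1) *: (b * d)]`_i.
Definition qi (i : 'I_3) : k := [:: 1; q ^- 4; q ^- 2]`_i.

Lemma sum3 (V : nmodType) (F : 'I_3 -> V) :
  \sum_i F i = F ord0 + F (@Ordinal 3 1 isT) + F (@Ordinal 3 2 isT).
Proof.
rewrite big_ord_recr big_ord_recr big_ord_recr big_ord0 /= add0r.
by congr (F _ + F _ + F _); apply: val_inj.
Qed.

Lemma sum_sfb_sfa : \sum_i sfb i * sfa i = 1.
Proof.
rewrite sum3 /sfb /sfa /= !expr2 !nc_rules !addrA.
rewrite (ACl (1*((2*3)*6)*((4*5)*7))) /= -!scalerDl.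
rewrite [X in _ + X *: _ + _](_ : _ = 0); last by field.
rewrite [X in _ + X *: _](_ : _ = 0); last by field.
by rewrite !scale0r !addr0.
Qed.

Lemma sum_sfa_sfb : \sum_i qi i *: (sfa i * sfb i) = 1.
Proof.
rewrite sum3 /sfb /sfa /qi /= !expr2 !nc_rules scale1r !addrA.
rewrite (ACl (1*((2*3)*6)*((4*5)*7))) /= -!scalerDl.
rewrite [X in _ + X *: _ + _](_ : _ = 0); last by field.
rewrite [X in _ + X *: _](_ : _ = 0); last by field.
by rewrite !scale0r !addr0.
Qed.

Lemma homog_sfb i : homog 2 (sfb i).
Proof.
have h1 := homog_alpha A; have h2 := homog_gamma A.
case: i => [[|[|[|//]]] hi]; rewrite /sfb /= ?expr2.
- exact: (homogMe h1 h1).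
- exact: (homogMe h2 h2).
- exact: (homogMe h1 h2).
Qed.

Lemma homog_sfa i : homog (-2) (sfa i).
Proof.
have h1 := homog_beta A; have h2 := homog_delta A.
case: i => [[|[|[|//]]] hi]; rewrite /sfa /= ?expr2.
- exact: (homogMe h2 h2).
- by apply: homogZ; exact: (homogMe h1 h1).
- by apply: homogZ; exact: (homogMe h1 h2).
Qed.

Lemma qi_neq0 i : qi i != 0.
Proof.
by case: i => [[|[|[|//]]] hi]; rewrite /qi /= ?oner_eq0 // invr_neq0 ?expf_neq0.
Qed.
End AlgebraFacts.

(* ---------------------- The 3D calculus on O_q(SL(2)) ---------------------- *)

(* Indices 0, +, - of the basis one-forms. *)
Definition i0 : 'I_3 := @Ordinal 3 0 isT.
Definition ip : 'I_3 := @Ordinal 3 1 isT.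
Definition im : 'I_3 := @Ordinal 3 2 isT.

Definition sigma_weight (i : 'I_3) : int := if i == i0 then 2 else 1.

(* These properties determine sigma and partial uniquely. *)
Record calculus3D (k : fieldType) (q : k) (hq : nonzero_not_root_of_unity q)
    (A : OqSL2 q) := {
  sigma : 'I_3 -> {linear A -> A};
  sigma_homog : forall i n x, homog n x ->
    sigma i x = q ^ (- (sigma_weight i * n)) *: x;
  partial : 'I_3 -> {linear A -> A};
  partialM : forall i x y,
    partial i (x * y) = partial i x * sigma i y + x * partial i y;
  partial0_gen :
    [/\ partial i0 alpha = alpha, partial i0 beta = - q ^+ 2 *: beta,
        partial i0 gamma = gamma & partial i0 delta = - q ^+ 2 *: delta];
  partialp_gen :
    [/\ partial ip alpha = - q *: beta, partial ip beta = 0,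
        partial ip gamma = - q *: delta & partial ip delta = 0];
  partialm_gen :
    [/\ partial im alpha = 0, partial im beta = alpha,
        partial im gamma = 0 & partial im delta = gamma]
}.

Variant ix_spec (i : 'I_3) : Prop :=
  | Ix0 of i = i0 | Ixp of i = ip | Ixm of i = im.

Lemma ix_cases i : ix_spec i.
Proof.
by case: i => [[|[|[|//]]] hi]; [apply: Ix0 | apply: Ixp | apply: Ixm];
  apply: val_inj.
Qed.

Lemma sum_ix (V : nmodType) (F : 'I_3 -> V) :
  \sum_i F i = F i0 + F ip + F im.
Proof. by rewrite sum3; congr (F _ + F _ + F _); apply: val_inj. Qed.

Section CalculusFacts.
Variables (k : fieldType) (q : k) (hq : nonzero_not_root_of_unity q).
Variables (A : OqSL2 q) (C : calculus3D hq A).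

Lemma sigma1 i : sigma C i 1 = 1.
Proof. by rewrite (sigma_homog C i (homog1 A)) mulr0 oppr0 expr0z scale1r. Qed.

Lemma sigma_B i (x : OqS2 A) : sigma C i (val x) = val x.
Proof.
by rewrite (sigma_homog C i (OqS2_homog x)) mulr0 oppr0 expr0z scale1r.
Qed.

Lemma sigma_pm : sigma C ip =1 sigma C im.
Proof.
apply: homog_span => [n x hx|x y hx hy]; last by rewrite !linearD /= hx hy.
by rewrite !(sigma_homog C _ hx).
Qed.

Lemma partial_1 i : partial C i 1 = 0.
Proof.
have := partialM C i 1 1; rewrite sigma1 !mul1r !mulr1 => h.
by apply: (addrI (partial C i 1)); rewrite addr0 -h.
Qed.

Definition partial_shift (i : 'I_3) : int :=
  if i == i0 then 0 else if i == ip then - 2%:Z else 2.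

Lemma partial_homog i n x :
  homog n x -> homog (n + partial_shift i) (partial C i x).
Proof.
have ha := homog_alpha A; have hb := homog_beta A.
have hg := homog_gamma A; have hd := homog_delta A.
have [a0 b0 c0 d0] := partial0_gen C.
have [ap bp cp dp] := partialp_gen C.
have [am bm cm dm] := partialm_gen C.
elim=> {n x}.
- by move=> n; rewrite linear0; exact: homog0.
- by rewrite partial_1; exact: homog0.
- by case: (ix_cases i) => ->; rewrite ?a0 ?ap ?am //=; [apply: homogZ | exact: homog0].
- by case: (ix_cases i) => ->; rewrite ?b0 ?bp ?bm //=; [apply: homogZ | exact: homog0].
- by case: (ix_cases i) => ->; rewrite ?c0 ?cp ?cm //=; [apply: homogZ | exact: homog0].
- by case: (ix_cases i) => ->; rewrite ?d0 ?dp ?dm //=; [apply: homogZ | exact: homog0].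
- by move=> n x y _ hx _ hy; rewrite linearD; exact: homogD.
- by move=> n e x _ hx; rewrite linearZ; exact: homogZ.
move=> m n x y hx IHx hy IHy; rewrite partialM.
apply: homogD; last by apply: (homogMe hx IHy); rewrite addrA.
rewrite (sigma_homog C i hy) -scalerAr; apply: homogZ.
by apply: (homogMe IHx hy); rewrite addrAC.
Qed.

Let q0 : q != 0. Proof. by case: hq. Qed.

Lemma sigmaM i x y : sigma C i (x * y) = sigma C i x * sigma C i y.
Proof.
move: x y; apply: homog_span => [m x hx|x x' hx hx' y]; last first.
  by rewrite mulrDl !linearD /= hx hx' mulrDl.
apply: homog_span => [n y hy|y y' hy hy']; last first.
  by rewrite mulrDr !linearD /= hy hy' mulrDr.
rewrite (sigma_homog C i hx) (sigma_homog C i hy).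
rewrite (sigma_homog C i (homogM hx hy)) -scalerAl -scalerAr scalerA.
by rewrite -expfzDr // mulrDr opprD.
Qed.

(* A linear inverse of sigma i. *)
Lemma sigma_inv i : exists tau : {linear A -> A},
  [/\ cancel (sigma C i) tau, cancel tau (sigma C i)
    & forall x y, tau (x * y) = tau x * tau y].
Proof.
set e := q ^ sigma_weight i.
have e0 : e != 0 by rewrite expfz_neq0.
have rel : SL2_relations q (e *: alpha : A) (e^-1 *: beta) (e *: gamma)
                           (e^-1 *: delta).
  have zz (s t : k) (x y : A) : (s *: x) * (t *: y) = (s * t) *: (x * y).
    by rewrite -scalerAl -scalerAr scalerA.
  have [[h1 h2 h3 h4 h5] [h6 h7]] := Oq_relations A.
  by split; [split|split]; rewrite !zz ?mulfV ?mulVf // ?scale1r //;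
    rewrite ?h1 ?h2 ?h3 ?h4 ?h5 !scalerA 1?mulrC ?mulfV ?mulVf // ?mulr1.
have [f [f1 fM] [fa fb fc fd]] : exists2 f : {linear A -> A},
    f 1 = 1 /\ (forall x y, f (x * y) = f x * f y) &
    [/\ f alpha = e *: alpha, f beta = e^-1 *: beta,
        f gamma = e *: gamma & f delta = e^-1 *: delta].
  have [g gP] := Oq_universal A rel; exists g => //.
  by split=> [|x y]; [exact: (rmorph1 g) | exact: (rmorphM g)].
have fz (c : k) : f c%:A = c%:A by rewrite linearZ /= f1.
have sz (c : k) : sigma C i c%:A = c%:A by rewrite linearZ /= sigma1.
have sg n x : homog n x -> sigma C i x = q ^ (- (sigma_weight i * n)) *: x.
  exact: sigma_homog.
have s1 x : homog 1 x -> sigma C i x = e^-1 *: x.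
  by move=> /sg ->; rewrite mulr1 invr_expz.
have sn x : homog (-1) x -> sigma C i x = e *: x.
  by move=> /sg ->; rewrite mulrN1 opprK.
have ha := homog_alpha A; have hb := homog_beta A.
have hg := homog_gamma A; have hd := homog_delta A.
exists f; split=> [x|x|x y]; last exact: fM.
  move: x; apply: (@Oq_generated _ _ A).
  - by move=> c; rewrite sz fz.
  - by move=> x y hx hy; rewrite !linearD /= hx hy.
  - by move=> x y hx hy; rewrite sigmaM fM hx hy.
  - by rewrite s1 // linearZ /= fa scalerA mulVf // scale1r.
  - by rewrite sn // linearZ /= fb scalerA mulfV // scale1r.
  - by rewrite s1 // linearZ /= fc scalerA mulVf // scale1r.
  - by rewrite sn // linearZ /= fd scalerA mulfV // scale1r.
move: x; apply: (@Oq_generated _ _ A).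
- by move=> c; rewrite fz sz.
- by move=> x y hx hy; rewrite !linearD /= hx hy.
- by move=> x y hx hy; rewrite fM sigmaM hx hy.
- by rewrite fa linearZ /= s1 // scalerA mulfV // scale1r.
- by rewrite fb linearZ /= sn // scalerA mulVf // scale1r.
- by rewrite fc linearZ /= s1 // scalerA mulfV // scale1r.
- by rewrite fd linearZ /= sn // scalerA mulVf // scale1r.
Qed.

Lemma partial0_homog n x : homog n x ->
  partial C i0 x = (q ^+ 2 * (q ^ (- (2 * n)) - 1) / (1 - q ^+ 2)) *: x.
Proof.
have q2 : 1 - q ^+ 2 != 0.
  by rewrite subr_eq0 eq_sym; case: hq => _ /(_ 2%N isT).
have [a0 b0 c0 d0] := partial0_gen C.
have l1 : q ^+ 2 * (q ^ (- (2 * 1)) - 1) / (1 - q ^+ 2) = 1.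
  by rewrite mulr1 -invr_expz -exprnP; field; rewrite q2 q0.
have ln : q ^+ 2 * (q ^ (- (2 * -1)) - 1) / (1 - q ^+ 2) = - q ^+ 2.
  by rewrite mulrN1 opprK -exprnP; field.
elim=> {n x}.
- by move=> n; rewrite linear0 scaler0.
- by rewrite partial_1 mulr0 oppr0 expr0z subrr mulr0 mul0r scale0r.
- by rewrite a0 l1 scale1r.
- by rewrite b0 ln.
- by rewrite c0 l1 scale1r.
- by rewrite d0 ln.
- by move=> n x y _ hx _ hy; rewrite linearD /= hx hy scalerDr.
- by move=> n e x _ hx; rewrite linearZ /= hx !scalerA mulrC.
move=> m n x y hx IHx hy IHy; rewrite partialM IHx IHy (sigma_homog C i0 hy).
rewrite -scalerAl -!scalerAr scalerA -scalerDl; congr (_ *: _).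
by rewrite /sigma_weight /= [_ * (m + n)]mulrDr opprD expfzDr //; field.
Qed.

End CalculusFacts.

Section Forms.
Variables (k : fieldType) (q : k) (hq : nonzero_not_root_of_unity q).
Variables (A : OqSL2 q) (C : calculus3D hq A).

(* Omega^1(A) in left coordinates: w stands for \sum_i w_i omega_i. *)
Definition Omega1A (_ : calculus3D hq A) := 'rV[A]_3.
Local Notation O1A := (Omega1A C).
HB.instance Definition _ := GRing.Lmodule.on O1A.

(* Omega^2(A) in left coordinates with respect to the basis
   omega_- omega_+, omega_0 omega_+, omega_- omega_0. *)
Definition Omega2A (_ : calculus3D hq A) := 'rV[A]_3.
Local Notation O2A := (Omega2A C).
HB.instance Definition _ := GRing.Lmodule.on O2A.

Definition row3 (x y z : A) : 'rV[A]_3 := \row_j [:: x; y; z]`_j.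

Lemma row3_0 x y z : row3 x y z 0 i0 = x. Proof. by rewrite mxE. Qed.
Lemma row3_p x y z : row3 x y z 0 ip = y. Proof. by rewrite mxE. Qed.
Lemma row3_m x y z : row3 x y z 0 im = z. Proof. by rewrite mxE. Qed.
Definition row3E := (row3_0, row3_p, row3_m).

Lemma row3P (u v : 'rV[A]_3) :
  u 0 i0 = v 0 i0 -> u 0 ip = v 0 ip -> u 0 im = v 0 im -> u = v.
Proof.
by move=> h0 hp hm; apply/rowP => i; case: (ix_cases i) => ->.
Qed.

Definition omega (i : 'I_3) : O1A := delta_mx 0 i.

(* omega_i a = sigma_i(a) omega_i *)
Definition Omega1A_rscale (w : O1A) (x : A) : O1A :=
  \row_i (w 0 i * sigma C i x).

Definition sigma2 (j : 'I_3) (x : A) : A :=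
  sigma C [:: im; i0; im]`_j (sigma C [:: ip; ip; i0]`_j x).

Definition Omega2A_rscale (v : O2A) (x : A) : O2A :=
  \row_j (v 0 j * sigma2 j x).

(* Product of one-forms: (x omega_i)(y omega_j) = x sigma_i(y) omega_i omega_j,
   with omega_i omega_j expressed in the basis of Omega^2(A), see the lemmas
   wedge_* below. *)
Definition wedge (u w : O1A) : O2A :=
  let m i j := u 0 i * sigma C i (w 0 j) in
  row3 (m im ip - q ^+ 2 *: m ip im)
       (m i0 ip - q ^+ 4 *: m ip i0)
       (m im i0 - q ^+ 4 *: m i0 im).

Lemma omegaE i j : omega i 0 j = (j == i)%:R.
Proof. by rewrite mxE eqxx. Qed.

Lemma wedge_sq i : wedge (omega i) (omega i) = 0.
Proof.
case: (ix_cases i) => ->; apply: row3P; rewrite [RHS]mxE !row3E !omegaE /=.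
all: by rewrite ?linear0 ?mulr0 ?mul0r ?scaler0 ?subrr.
Qed.

Let om_simp := (linear0, sigma1, mulr0, mul0r, mulr1, mul1r, scaler0,
  subr0, sub0r, oppr0, scaleNr).

Lemma wedge_mp : wedge (omega im) (omega ip) = row3 1 0 0.
Proof. by apply: row3P; rewrite !row3E !omegaE /= ?om_simp. Qed.
Lemma wedge_0p : wedge (omega i0) (omega ip) = row3 0 1 0.
Proof. by apply: row3P; rewrite !row3E !omegaE /= ?om_simp. Qed.
Lemma wedge_m0 : wedge (omega im) (omega i0) = row3 0 0 1.
Proof. by apply: row3P; rewrite !row3E !omegaE /= ?om_simp. Qed.
Lemma wedge_pm : wedge (omega ip) (omega im) =
  (- q ^+ 2)%:A *: wedge (omega im) (omega ip).
Proof. by apply: row3P; rewrite [RHS]mxE wedge_mp !row3E !omegaE /= ?om_simp. Qed.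
Lemma wedge_0m : wedge (omega i0) (omega im) =
  (- q ^+ 4)%:A *: wedge (omega im) (omega i0).
Proof. by apply: row3P; rewrite [RHS]mxE wedge_m0 !row3E !omegaE /= ?om_simp. Qed.
Lemma wedge_p0 : wedge (omega ip) (omega i0) =
  (- q ^+ 4)%:A *: wedge (omega i0) (omega ip).
Proof. by apply: row3P; rewrite [RHS]mxE wedge_0p !row3E !omegaE /= ?om_simp. Qed.

Definition dA0 (x : A) : O1A := \row_i partial C i x.

Definition domega (i : 'I_3) : O2A :=
  [:: q%:A *: wedge (omega im) (omega ip);
      (q ^+ 2 * (q ^+ 2 + 1))%:A *: wedge (omega i0) (omega ip);
      (q ^+ 2 * (q ^+ 2 + 1))%:A *: wedge (omega im) (omega i0)]`_i.

(* d(x omega_i) = dx omega_i + x d(omega_i) *)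
Definition dA1 (w : O1A) : O2A :=
  \sum_i (wedge (dA0 (w 0 i)) (omega i) + w 0 i *: domega i).


Fact Omega1A_rscale1 w : Omega1A_rscale w 1 = w.
Proof. by apply/rowP => i; rewrite mxE sigma1 mulr1. Qed.
Fact Omega1A_rscaleA w x y :
  Omega1A_rscale w (x * y) = Omega1A_rscale (Omega1A_rscale w x) y.
Proof. by apply/rowP => i; rewrite !mxE sigmaM mulrA. Qed.
Fact Omega1A_rscaleDl u w x :
  Omega1A_rscale (u + w) x = Omega1A_rscale u x + Omega1A_rscale w x.
Proof. by apply/rowP => i; rewrite !mxE mulrDl. Qed.
Fact Omega1A_rscaleDr w x y :
  Omega1A_rscale w (x + y) = Omega1A_rscale w x + Omega1A_rscale w y.
Proof. by apply/rowP => i; rewrite !mxE linearD mulrDr. Qed.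
Fact Omega1A_scale_rscale x w y :
  Omega1A_rscale (x *: w) y = x *: Omega1A_rscale w y.
Proof. by apply/rowP => i; rewrite !mxE mulrA. Qed.
HB.instance Definition _ := Lmodule_isBimodule.Build A O1A
  Omega1A_rscale1 Omega1A_rscaleA Omega1A_rscaleDl Omega1A_rscaleDr
  Omega1A_scale_rscale.

Fact Omega2A_rscale1 w : Omega2A_rscale w 1 = w.
Proof. by apply/rowP => i; rewrite mxE /sigma2 !sigma1 mulr1. Qed.
Fact Omega2A_rscaleA w x y :
  Omega2A_rscale w (x * y) = Omega2A_rscale (Omega2A_rscale w x) y.
Proof. by apply/rowP => i; rewrite !mxE /sigma2 !sigmaM mulrA. Qed.
Fact Omega2A_rscaleDl u w x :
  Omega2A_rscale (u + w) x = Omega2A_rscale u x + Omega2A_rscale w x.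
Proof. by apply/rowP => i; rewrite !mxE mulrDl. Qed.
Fact Omega2A_rscaleDr w x y :
  Omega2A_rscale w (x + y) = Omega2A_rscale w x + Omega2A_rscale w y.
Proof. by apply/rowP => i; rewrite !mxE /sigma2 !linearD mulrDr. Qed.
Fact Omega2A_scale_rscale x w y :
  Omega2A_rscale (x *: w) y = x *: Omega2A_rscale w y.
Proof. by apply/rowP => i; rewrite !mxE mulrA. Qed.
HB.instance Definition _ := Lmodule_isBimodule.Build A O2A
  Omega2A_rscale1 Omega2A_rscaleA Omega2A_rscaleDl Omega2A_rscaleDr
  Omega2A_scale_rscale.

Lemma Omega1A_rE (w : O1A) x i : (w *< x : O1A) 0 i = w 0 i * sigma C i x.
Proof. by rewrite mxE. Qed.
Lemma Omega2A_rE (w : O2A) x j : (w *< x : O2A) 0 j = w 0 j * sigma2 j x.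
Proof. by rewrite mxE. Qed.
Lemma Omega1A_lE (w : O1A) x i : (x *: w : O1A) 0 i = x * w 0 i.
Proof. by rewrite mxE. Qed.
Lemma Omega2A_lE (w : O2A) x i : (x *: w : O2A) 0 i = x * w 0 i.
Proof. by rewrite mxE. Qed.

Lemma sigma2_B j (x : OqS2 A) : sigma2 j (val x) = val x.
Proof. by rewrite /sigma2 !sigma_B. Qed.

End Forms.

(* --------------------------- The calculus on B --------------------------- *)

Section SubBimodules.
Variables (k : fieldType) (q : k) (A : OqSL2 q).
Local Notation B := (OqS2 A).
Variable M : bimodType A.

Record subBimod := SubBimod {
  sub_set : M -> Prop;
  sub_set0 : sub_set 0;
  sub_setD : forall u v, sub_set u -> sub_set v -> sub_set (u + v);
  sub_setl : forall (b : B) u, sub_set u -> sub_set (val b *: u);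
  sub_setr : forall (b : B) u, sub_set u -> sub_set (u *< val b)
}.

Definition sub_pred (S : subBimod) : {pred M} := fun u => `[< sub_set S u >].

Fact sub_pred_zmod S : zmod_closed (sub_pred S).
Proof.
split; first by apply/asboolP; exact: sub_set0.
move=> u v /asboolP hu /asboolP hv; apply/asboolP; apply: sub_setD => //.
by have := sub_setl (-1) hv; rewrite /= scaleN1r.
Qed.
HB.instance Definition _ S :=
  GRing.isZmodClosed.Build _ (sub_pred S) (sub_pred_zmod S).

(* A B-subbimodule of M, as a B-bimodule. *)
Definition sub_type (S : subBimod) := {u : M | u \in sub_pred S}.
HB.instance Definition _ S := [isSub of sub_type S for sval].
HB.instance Definition _ S := [Choice of sub_type S by <:].
HB.instance Definition _ S := [SubChoice_isSubZmodule of sub_type S by <:].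

Section Instances.
Variable S : subBimod.

Definition mk_sub u (hu : sub_set S u) : sub_type S :=
  exist _ u (introT (asboolP _) hu).

Lemma sub_typeP (u : sub_type S) : sub_set S (val u).
Proof. by apply/asboolP; exact: (valP u). Qed.

Definition sub_scale (b : B) (u : sub_type S) :=
  mk_sub (sub_setl b (sub_typeP u)).
Definition sub_rscale (u : sub_type S) (b : B) :=
  mk_sub (sub_setr b (sub_typeP u)).

Fact sub_scaleA x y u : sub_scale x (sub_scale y u) = sub_scale (x * y) u.
Proof. by apply: val_inj; rewrite /= scalerA. Qed.
Fact sub_scale1 : left_id 1 sub_scale.
Proof. by move=> u; apply: val_inj; rewrite /= scale1r. Qed.
Fact sub_scaleDr : right_distributive sub_scale +%R.
Proof. by move=> x u v; apply: val_inj; rewrite /= scalerDr. Qed.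
Fact sub_scaleDl u : {morph sub_scale^~ u : x y / x + y}.
Proof. by move=> x y; apply: val_inj; rewrite /= scalerDl. Qed.
HB.instance Definition _ := GRing.Zmodule_isLmodule.Build B (sub_type S)
  sub_scaleA sub_scale1 sub_scaleDr sub_scaleDl.

Fact sub_rscale1 u : sub_rscale u 1 = u.
Proof. by apply: val_inj; rewrite /= rscale1. Qed.
Fact sub_rscaleA u x y : sub_rscale u (x * y) = sub_rscale (sub_rscale u x) y.
Proof. by apply: val_inj; rewrite /= rscaleA. Qed.
Fact sub_rscaleDl u v x : sub_rscale (u + v) x = sub_rscale u x + sub_rscale v x.
Proof. by apply: val_inj; rewrite /= rscaleDl. Qed.
Fact sub_rscaleDr u x y : sub_rscale u (x + y) = sub_rscale u x + sub_rscale u y.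
Proof. by apply: val_inj; rewrite /= rscaleDr. Qed.
Fact sub_scale_rscale x u y : sub_rscale (x *: u) y = x *: sub_rscale u y.
Proof. by apply: val_inj; rewrite /= scale_rscale. Qed.
HB.instance Definition _ := Lmodule_isBimodule.Build B (sub_type S)
  sub_rscale1 sub_rscaleA sub_rscaleDl sub_rscaleDr sub_scale_rscale.

Lemma val_subr (u : sub_type S) (b : B) : val (u *< b) = val u *< val b.
Proof. by []. Qed.
Lemma val_subl (u : sub_type S) (b : B) : val (b *: u) = val b *: val u.
Proof. by []. Qed.

End Instances.

(* The B-subbimodule generated by G: the smallest one containing G. *)
Definition bspan_set (G : M -> Prop) (u : M) : Prop :=
  forall S : subBimod, (forall g, G g -> sub_set S g) -> sub_set S u.

Lemma bspan_gen (G : M -> Prop) g : G g -> bspan_set G g.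
Proof. by move=> Gg S; apply. Qed.

Fact bspan_set0 G : bspan_set G 0.
Proof. by move=> S _; exact: sub_set0. Qed.
Fact bspan_setD G u v : bspan_set G u -> bspan_set G v -> bspan_set G (u + v).
Proof. by move=> hu hv S GS; apply: sub_setD; [exact: hu | exact: hv]. Qed.
Fact bspan_setl G (b : B) u : bspan_set G u -> bspan_set G (val b *: u).
Proof. by move=> hu S GS; apply: sub_setl; exact: hu. Qed.
Fact bspan_setr G (b : B) u : bspan_set G u -> bspan_set G (u *< val b).
Proof. by move=> hu S GS; apply: sub_setr; exact: hu. Qed.

Definition bspan (G : M -> Prop) : subBimod :=
  SubBimod (@bspan_set0 G) (@bspan_setD G) (@bspan_setl G) (@bspan_setr G).

Lemma sub_set_sum (S : subBimod) n (u : 'I_n -> M) :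
  (forall i, sub_set S (u i)) -> sub_set S (\sum_i u i).
Proof. by move=> h; apply: big_ind => //; [exact: sub_set0 | exact: sub_setD]. Qed.

Lemma val_sub_sum (S : subBimod) n (u : 'I_n -> sub_type S) :
  val (\sum_i u i) = \sum_i val (u i).
Proof. exact: (big_morph val). Qed.

Lemma sub_setB (S : subBimod) u v :
  sub_set S u -> sub_set S v -> sub_set S (u - v).
Proof.
by move=> hu hv; apply: sub_setD => //; have := sub_setl (-1) hv; rewrite /= scaleN1r.
Qed.

End SubBimodules.

Coercion sub_type : subBimod >-> Sortclass.

Section CalculusB.
Variables (k : fieldType) (q : k) (hq : nonzero_not_root_of_unity q).
Variables (A : OqSL2 q) (C : calculus3D hq A).
Local Notation B := (OqS2 A).
Let q0 : q != 0. Proof. by case: hq. Qed.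

Definition Omega1B : subBimod (Omega1A C) :=
  bspan (fun w => exists b : B, w = dA0 C (val b)).

Definition Omega2B : subBimod (Omega2A C) :=
  bspan (fun v => exists u w : Omega1B, v = wedge (val u) (val w)).

(* Explicit description of Omega^1(B): the forms x omega_- + y omega_+ with
   |x| = 2 and |y| = -2. *)
Definition form1B (w : Omega1A C) : Prop :=
  [/\ w 0 i0 = 0, homog (-2) (w 0 ip) & homog 2 (w 0 im)].

Fact form1B_0 : form1B 0.
Proof. by split; rewrite mxE //; exact: homog0. Qed.
Fact form1B_D u v : form1B u -> form1B v -> form1B (u + v).
Proof.
move=> [u0 up um] [v0 vp vm].
by split; rewrite mxE ?u0 ?v0 ?addr0 //; exact: homogD.
Qed.
Fact form1B_l (b : B) u : form1B u -> form1B (val b *: u).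
Proof.
move=> [u0 up um]; have hb := OqS2_homog b.
split; rewrite mxE ?u0 ?mulr0 //; first exact: (homogMe hb up).
exact: (homogMe hb um).
Qed.
Fact form1B_r (b : B) u : form1B u -> form1B (u *< val b).
Proof.
move=> [u0 up um]; have hb := OqS2_homog b.
split; rewrite Omega1A_rE sigma_B ?u0 ?mul0r //; first exact: (homogMe up hb).
exact: (homogMe um hb).
Qed.
Definition form1B_sub := SubBimod form1B_0 form1B_D form1B_l form1B_r.

Lemma form1B_dA0 (b : B) : form1B (dA0 C (val b)).
Proof.
have hb := OqS2_homog b; split; rewrite mxE.
- by rewrite (partial0_homog C hb) mulr0 oppr0 expr0z subrr mulr0 mul0r scale0r.
- by have := partial_homog C ip hb; rewrite add0r.
- by have := partial_homog C im hb; rewrite add0r.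
Qed.

Lemma Omega1B_form w : sub_set Omega1B w -> form1B w.
Proof. by move=> /(_ form1B_sub); apply=> _ [b ->]; exact: form1B_dA0. Qed.

Lemma sigma_gen :
  [/\ forall x, homog 1 x -> sigma C ip x = q^-1 *: x,
      forall x, homog (-1) x -> sigma C ip x = q *: x,
      forall x, homog 1 x -> sigma C im x = q^-1 *: x
    & forall x, homog (-1) x -> sigma C im x = q *: x].
Proof.
by split=> x hx; rewrite (sigma_homog C _ hx) /= ?mulr1 ?mulrN1 ?opprK.
Qed.


Lemma Omega1B_dA0_row (x : B) :
  sub_set Omega1B (row3 0 (partial C ip (val x)) (partial C im (val x))).
Proof.
rewrite (_ : row3 _ _ _ = dA0 C (val x)); first by apply: bspan_gen; exists x.
by have [h _ _] := form1B_dA0 x; apply: row3P; rewrite !row3E // mxE.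
Qed.

Lemma Omega1B_comb (b b' : B) (y z y' z' y'' z'' : A) :
  sub_set Omega1B (row3 0 y z) -> sub_set Omega1B (row3 0 y' z') ->
  val b * y - val b' * y' = y'' -> val b * z - val b' * z' = z'' ->
  sub_set Omega1B (row3 0 y'' z'').
Proof.
move=> h h' <- <-; rewrite (_ : row3 _ _ _ =
    val b *: (row3 0 y z : Omega1A C) - val b' *: (row3 0 y' z' : Omega1A C)).
  by apply: sub_setB; apply: sub_setl.
by apply: row3P; rewrite !mxE /= ?mulr0 ?subrr.
Qed.

Lemma Omega1B_gen i :
  sub_set Omega1B (row3 0 0 (sfb A i)) /\ sub_set Omega1B (row3 0 (sfa A i) 0).
Proof.
have ha := homog_alpha A; have hb := homog_beta A.
have hg := homog_gamma A; have hd := homog_delta A.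
have [sp1 spn sm1 smn] := sigma_gen.
have [ap bp cp dp] := partialp_gen C.
have [am bm cm dm] := partialm_gen C.
pose x1 : B := mkB (homogM ha hb); pose x2 : B := mkB (homogM hg hd).
pose x3 : B := mkB (homogM hb hg).
have p1 : sub_set Omega1B (row3 0 (- q ^+ 2 *: (beta * beta)) (alpha * alpha)).
  have := Omega1B_dA0_row x1.
  rewrite /= !partialM ap bp am bm !(spn _ hb) !(smn _ hb).
  by rewrite mul0r mulr0 addr0 add0r -!(scalerAl, scalerAr) scalerA mulNr -expr2.
have p2 : sub_set Omega1B (row3 0 (- q ^+ 2 *: (delta * delta)) (gamma * gamma)).
  have := Omega1B_dA0_row x2.
  rewrite /= !partialM cp dp cm dm !(spn _ hd) !(smn _ hd).
  by rewrite mul0r mulr0 addr0 add0r -!(scalerAl, scalerAr) scalerA mulNr -expr2.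
have p3 : sub_set Omega1B (row3 0 (- q *: (beta * delta)) (q^-1 *: (alpha * gamma))).
  have := Omega1B_dA0_row x3.
  rewrite /= !partialM bp cp bm cm !(sp1 _ hg) !(sm1 _ hg).
  by rewrite mul0r mulr0 addr0 add0r -!(scalerAl, scalerAr).
pose s (e : k) (x : B) : B := e *: x.
have pc : sub_set Omega1B (row3 0 0 (gamma * gamma)).
  apply: (Omega1B_comb (b := s q x2) (b' := s q^-1 x3) p3 p2);
    rewrite /= !(nc_rules hq A).
    by rewrite -scalerBl (_ : _ - _ = 0) ?scale0r //; field.
  rewrite -addrA -scalerBl (_ : _ - _ = 0) ?scale0r ?addr0; last by field.
  by rewrite (_ : _ / q = 1) ?scale1r //; field.
have pa : sub_set Omega1B (row3 0 0 (alpha * alpha)).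
  apply: (Omega1B_comb (b := 1 + s q x3) (b' := s q^-1 x1) p1 p3);
    rewrite /= !(nc_rules hq A).
    rewrite opprD addrACA -!scalerBl.
    rewrite [X in X *: _ + _](_ : _ = 0); last by field.
    by rewrite [X in _ + X *: _](_ : _ = 0); [rewrite !scale0r addr0 | field].
  by rewrite -addrA -scalerBl (_ : _ - _ = 0) ?scale0r ?addr0 //; field.
have pac : sub_set Omega1B (row3 0 0 (alpha * gamma)).
  apply: (Omega1B_comb (b := s q x2) (b' := s (q ^- 3) x1) pa pc);
    rewrite /= !(nc_rules hq A).
    by rewrite !mulr0 !scaler0 subrr.
  rewrite -addrA -scalerBl (_ : _ - _ = 0) ?scale0r ?addr0 //.
  by field.
have pbb : sub_set Omega1B (row3 0 (sfa A ip) 0).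
  apply: (Omega1B_comb (b := s (-1) 1) (b' := s (-1) 1) p1 pa); rewrite /sfa /= ?expr2.
    by rewrite mulr0 subr0 -scalerAl mul1r scaleN1r -scaleNr opprK.
  by rewrite subrr.
have pdd : sub_set Omega1B (row3 0 (sfa A i0) 0).
  apply: (Omega1B_comb (b := s (- q ^- 2) 1) (b' := s (- q ^- 2) 1) p2 pc);
   rewrite /sfa /= ?expr2.
    rewrite mulr0 subr0 -scalerAl mul1r scalerA mulrNN mulVf ?scale1r //.
    by rewrite mulf_neq0.
  by rewrite subrr.
have pbd : sub_set Omega1B (row3 0 (sfa A im) 0).
  apply: (Omega1B_comb (b := s (1 + q ^- 2) 1) (b' := s ((1 + q ^- 2) / q) 1)
    p3 pac); rewrite /sfa /= ?expr2.
    rewrite mulr0 subr0 -scalerAl mul1r scalerA; congr (_ *: _).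
    by field.
  by rewrite -!scalerAl !mul1r scalerA subrr.
by case: (ix_cases i) => ->; split.
Qed.


Lemma Omega1BP w : sub_set Omega1B w <-> form1B w.
Proof.
split; first exact: Omega1B_form.
move=> [w0 hp hm].
have -> : w = (\sum_i ((w 0 ip * sfb A i) *: (row3 0 (sfa A i) 0 : Omega1A C)))
            + (\sum_i ((qi q i *: (w 0 im * sfa A i)) *:
                       (row3 0 0 (sfb A i) : Omega1A C))).
  apply: row3P; rewrite mxE !summxE.
  - by rewrite !big1 ?addr0 // => i _; rewrite mxE row3_0 mulr0.
  - rewrite [X in _ + X]big1 => [|i _]; last by rewrite mxE row3_p mulr0.
    rewrite addr0 -[LHS]mulr1 -(sum_sfb_sfa hq A) mulr_sumr.
    by apply: eq_bigr => i _; rewrite mxE row3_p mulrA.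
  - rewrite [X in X + _]big1 => [|i _]; last by rewrite mxE row3_m mulr0.
    rewrite add0r -[LHS]mulr1 -(sum_sfa_sfb hq A) mulr_sumr.
    by apply: eq_bigr => i _; rewrite mxE row3_m -scalerAl -scalerAr mulrA.
apply: sub_setD; apply: sub_set_sum => i.
  have hb : homog 0 (w 0 ip * sfb A i) by exact: (homogMe hp (homog_sfb A i)).
  by apply: (sub_setl (mkB hb)); case: (Omega1B_gen i).
have hb : homog 0 (qi q i *: (w 0 im * sfa A i)).
  by apply: homogZ; exact: (homogMe hm (homog_sfa A i)).
by apply: (sub_setl (mkB hb)); case: (Omega1B_gen i).
Qed.

Lemma Omega1BE (w : Omega1B) : form1B (val w).
Proof. exact: Omega1B_form (sub_typeP w). Qed.

(* Explicit description of Omega^2(B): the forms x omega_- omega_+, x in B. *)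
Definition form2B (v : Omega2A C) : Prop :=
  [/\ homog 0 (v 0 i0), v 0 ip = 0 & v 0 im = 0].

Fact form2B_0 : form2B 0.
Proof. by split; rewrite mxE //; exact: homog0. Qed.
Fact form2B_D u v : form2B u -> form2B v -> form2B (u + v).
Proof.
move=> [u0 up um] [v0 vp vm].
by split; rewrite mxE ?up ?um ?vp ?vm ?addr0 //; exact: homogD.
Qed.
Fact form2B_l (b : B) u : form2B u -> form2B (val b *: u).
Proof.
move=> [u0 up um]; have hb := OqS2_homog b.
split; rewrite mxE ?up ?um ?mulr0 //; exact: (homogMe hb u0).
Qed.
Fact form2B_r (b : B) u : form2B u -> form2B (u *< val b).
Proof.
move=> [u0 up um]; have hb := OqS2_homog b.
split; rewrite Omega2A_rE sigma2_B ?up ?um ?mul0r //; exact: (homogMe u0 hb).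
Qed.
Definition form2B_sub := SubBimod form2B_0 form2B_D form2B_l form2B_r.

Lemma sigma_n2 x : homog (-2) x ->
  (sigma C ip x = q ^+ 2 *: x) * (sigma C im x = q ^+ 2 *: x).
Proof. by move=> hx; rewrite !(sigma_homog C _ hx) /= mul1r opprK. Qed.
Lemma sigma_p2 x : homog 2 x ->
  (sigma C ip x = q ^- 2 *: x) * (sigma C im x = q ^- 2 *: x).
Proof. by move=> hx; rewrite !(sigma_homog C _ hx) /= mul1r. Qed.

Lemma wedge_form u w : form1B u -> form1B w ->
  wedge u w = row3 (q ^+ 2 *: (u 0 im * w 0 ip) - u 0 ip * w 0 im) 0 0.
Proof.
move=> [u0 up um] [w0 wp wm]; apply: row3P; rewrite !row3E ?u0 ?w0.
- rewrite (sigma_n2 wp) (sigma_p2 wm) -!scalerAr scalerA mulfV ?scale1r //.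
  by rewrite expf_neq0.
- by rewrite linear0 mul0r mulr0 scaler0 subrr.
- by rewrite linear0 mul0r mulr0 scaler0 subrr.
Qed.

Lemma Omega2B_form v : sub_set Omega2B v -> form2B v.
Proof.
move=> /(_ form2B_sub); apply=> _ [u [w ->]].
have hu := Omega1BE u; have hw := Omega1BE w; rewrite wedge_form //.
case: hu hw => [u0 up um] [w0 wp wm]; split; rewrite row3E //.
apply: homogD; first by apply: homogZ; exact: (homogMe um wp).
by apply: homogN; exact: (homogMe up wm).
Qed.

Lemma form1B_row3 y x : homog (-2) y -> homog 2 x -> form1B (row3 0 y x).
Proof. by move=> hy hx; split; rewrite row3E. Qed.

Lemma Omega2B_gen : sub_set Omega2B (wedge (omega C im) (omega C ip)).
Proof.
rewrite wedge_mp.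
have hx i : sub_set Omega2B (row3 (sfb A i * sfa A i) 0 0).
  have hb := homog_sfb A i; have ha := homog_sfa A i.
  have h : form1B (row3 0 (q ^- 2 *: sfa A i) 0).
    by apply: form1B_row3; [exact: homogZ | exact: homog0].
  have h' : form1B (row3 0 0 (sfb A i)) by apply: form1B_row3 => //; exact: homog0.
  apply: bspan_gen; exists (mk_sub ((Omega1BP _).2 h')).
  exists (mk_sub ((Omega1BP _).2 h)); rewrite /= wedge_form // !row3E.
  by rewrite mul0r subr0 -scalerAr scalerA mulfV ?expf_neq0 // scale1r.
have -> : row3 1 0 0 = \sum_i (row3 (sfb A i * sfa A i) 0 0 : Omega2A C).
  rewrite -(sum_sfb_sfa hq A); apply: row3P; rewrite summxE.
  - by rewrite row3E; apply: eq_bigr => i _; rewrite row3E.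
  - by rewrite row3E big1 // => i _; rewrite row3E.
  - by rewrite row3E big1 // => i _; rewrite row3E.
exact: sub_set_sum.
Qed.

Lemma Omega2BP v : sub_set Omega2B v <-> form2B v.
Proof.
split; first exact: Omega2B_form.
move=> [h0 hp hm].
have -> : v = v 0 i0 *: wedge (omega C im) (omega C ip).
  by apply: row3P; rewrite mxE wedge_mp row3E ?mulr1 ?mulr0.
exact: (sub_setl (mkB h0) Omega2B_gen).
Qed.

Lemma Omega2BE (v : Omega2B) : form2B (val v).
Proof. exact: Omega2B_form (sub_typeP v). Qed.

(* The de Rham complex of B *)
Lemma dB0_subproof (b : B) : sub_set Omega1B (dA0 C (val b)).
Proof. by apply: bspan_gen; exists b. Qed.
Definition dB0 (b : B^o) : Omega1B := mk_sub (dB0_subproof b).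

Lemma dA1_form w : form1B w ->
  dA1 w = row3 (partial C im (w 0 ip) - q ^+ 2 *: partial C ip (w 0 im)) 0 0.
Proof.
move=> [w0 wp wm]; have q2 : 1 - q ^+ 2 != 0.
  by rewrite subr_eq0 eq_sym; case: hq => _ /(_ 2%N isT).
have dA00 : dA0 C 0 = 0 by apply/rowP => i; rewrite !mxE linear0.
have hp : partial C i0 (w 0 ip) = - (q ^+ 2 * (q ^+ 2 + 1)) *: w 0 ip.
  rewrite (partial0_homog C wp); congr (_ *: _).
  by rewrite (_ : - (2 * - 2%:Z) = 4%:Z) // -exprnP; field.
have hm : partial C i0 (w 0 im) = (q ^- 2 * (q ^+ 2 + 1)) *: w 0 im.
  rewrite (partial0_homog C wm); congr (_ *: _).
  by rewrite (_ : 2 * 2 = 4%:Z) // -invr_expz -exprnP; field; rewrite q0.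
rewrite /dA1 sum_ix w0 dA00 scale0r addr0 /domega /= wedge_0p wedge_m0.
have w00 i : wedge (0 : Omega1A C) (omega C i) = 0.
  by apply: row3P; rewrite !row3E !mxE /= !mul0r scaler0 subrr.
rewrite w00 add0r.
have z := (linear0, sigma1, mulr0, mul0r, mulr1, scaler0, subr0, sub0r, oppr0,
           addr0, add0r).
apply: row3P; rewrite !mxE /= ?mxE /= ?z //.
- by rewrite hp -scalerAr mulr1 scaleNr addNr.
- rewrite hm -scalerAr mulr1 scalerA -scaleNr -scalerDl.
  by rewrite (_ : _ + _ = 0) ?scale0r //; field.
Qed.

Lemma dB1_subproof (w : Omega1B) : sub_set Omega2B (dA1 (val w)).
Proof.
have hw := Omega1BE w; apply/Omega2BP; rewrite dA1_form //.
case: hw => [_ hp hm]; split; rewrite row3E //.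
apply: homogD; first exact: (partial_homog C im hp).
by apply: homogN; apply: homogZ; exact: (partial_homog C ip hm).
Qed.
Definition dB1 (w : Omega1B) : Omega2B := mk_sub (dB1_subproof w).

Lemma wedgeB_subproof (u w : Omega1B) : sub_set Omega2B (wedge (val u) (val w)).
Proof. by apply: bspan_gen; exists u, w. Qed.
Definition wedgeB (u w : Omega1B) : Omega2B := mk_sub (wedgeB_subproof u w).

(* omega_- omega_+ and Theta(b) = omega_- omega_+ b *)
Definition omega_mp : Omega2B := mk_sub Omega2B_gen.
Definition Theta (b : B^o) : Omega2B := omega_mp *< (b : B).

(* phi is the right B-linear map Omega^2(B) -> B with phi(omega_- omega_+) = 1;
   as omega_- omega_+ is central in Omega^2(B), it is the coefficient map. *)
Definition phi_fun (v : Omega2B) : B := mkB (let: And3 h _ _ := Omega2BE v in h).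

Lemma phi_subproof : rlinear phi_fun.
Proof.
split=> [u v|u b]; apply: val_inj; rewrite /= ?mxE //.
by rewrite sigma2_B.
Qed.
Definition phi : rdual Omega2B := mk_rdual phi_subproof.

Lemma phi_mp : phi omega_mp = 1.
Proof. by apply: val_inj; rewrite /= wedge_mp row3E. Qed.

Definition Theta_star (b : B^o) : rdual Omega2B := phi *< (b : B).

(* The decomposition Omega^1(B) = Gamma_+ (+) Gamma_- and its dual bases *)
Definition ww (i : 'I_3) : Omega1A C := omega C ip *< sfa A i.
Definition uu (i : 'I_3) : Omega1A C := omega C im *< sfb A i.

Definition Gamma_p : subBimod (Omega1A C) := bspan (fun w => exists i, w = ww i).
Definition Gamma_m : subBimod (Omega1A C) := bspan (fun w => exists i, w = uu i).

Lemma omega_p_r y : homog (-2) y -> omega C ip *< y = row3 0 (q ^+ 2 *: y) 0.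
Proof.
move=> hy; apply: row3P; rewrite row3E Omega1A_rE omegaE /= ?mul0r //.
by rewrite mul1r (sigma_n2 hy).
Qed.
Lemma omega_m_r x : homog 2 x -> omega C im *< x = row3 0 0 (q ^- 2 *: x).
Proof.
move=> hx; apply: row3P; rewrite row3E Omega1A_rE omegaE /= ?mul0r //.
by rewrite mul1r (sigma_p2 hx).
Qed.

Definition formp (w : Omega1A C) : Prop :=
  [/\ w 0 i0 = 0, homog (-2) (w 0 ip) & w 0 im = 0].
Definition formm (w : Omega1A C) : Prop :=
  [/\ w 0 i0 = 0, w 0 ip = 0 & homog 2 (w 0 im)].

Fact formp_0 : formp 0.
Proof. by split; rewrite mxE //; exact: homog0. Qed.
Fact formp_D u v : formp u -> formp v -> formp (u + v).
Proof.
move=> [u0 up um] [v0 vp vm].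
by split; rewrite mxE ?u0 ?v0 ?um ?vm ?addr0 //; exact: homogD.
Qed.
Fact formp_l (b : B) u : formp u -> formp (val b *: u).
Proof.
move=> [u0 up um]; have hb := OqS2_homog b.
by split; rewrite mxE ?u0 ?um ?mulr0 //; exact: (homogMe hb up).
Qed.
Fact formp_r (b : B) u : formp u -> formp (u *< val b).
Proof.
move=> [u0 up um]; have hb := OqS2_homog b.
by split; rewrite Omega1A_rE sigma_B ?u0 ?um ?mul0r //; exact: (homogMe up hb).
Qed.
Definition formp_sub := SubBimod formp_0 formp_D formp_l formp_r.

Fact formm_0 : formm 0.
Proof. by split; rewrite mxE //; exact: homog0. Qed.
Fact formm_D u v : formm u -> formm v -> formm (u + v).
Proof.
move=> [u0 up um] [v0 vp vm].
by split; rewrite mxE ?u0 ?v0 ?up ?vp ?addr0 //; exact: homogD.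
Qed.
Fact formm_l (b : B) u : formm u -> formm (val b *: u).
Proof.
move=> [u0 up um]; have hb := OqS2_homog b.
by split; rewrite mxE ?u0 ?up ?mulr0 //; exact: (homogMe hb um).
Qed.
Fact formm_r (b : B) u : formm u -> formm (u *< val b).
Proof.
move=> [u0 up um]; have hb := OqS2_homog b.
by split; rewrite Omega1A_rE sigma_B ?u0 ?up ?mul0r //; exact: (homogMe um hb).
Qed.
Definition formm_sub := SubBimod formm_0 formm_D formm_l formm_r.

Lemma Gamma_pP w : sub_set Gamma_p w <-> formp w.
Proof.
split=> [/(_ formp_sub)|[h0 hp hm]].
  apply=> _ [i ->] /=; have ha := homog_sfa A i.
  by rewrite /ww omega_p_r //; split; rewrite row3E //; exact: homogZ.
have hb i : homog 0 (q ^- 2 *: (w 0 ip * sfb A i)).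
  by apply: homogZ; exact: (homogMe hp (homog_sfb A i)).
have -> : w = \sum_i val (mkB (hb i)) *: ww i.
  apply: row3P; rewrite summxE.
  - by rewrite big1 // => i _; rewrite Omega1A_lE /ww omega_p_r ?row3E ?mulr0 //; exact: homog_sfa.
  - rewrite -[LHS]mulr1 -(sum_sfb_sfa hq A) mulr_sumr; apply: eq_bigr => i _.
    rewrite Omega1A_lE /ww omega_p_r ?row3E /=; last exact: homog_sfa.
    by rewrite -scalerAl -scalerAr scalerA mulVf ?expf_neq0 // scale1r mulrA.
  - by rewrite big1 // => i _; rewrite Omega1A_lE /ww omega_p_r ?row3E ?mulr0 //; exact: homog_sfa.
by apply: sub_set_sum => i; apply: sub_setl; apply: bspan_gen; exists i.
Qed.

Lemma Gamma_mP w : sub_set Gamma_m w <-> formm w.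
Proof.
split=> [/(_ formm_sub)|[h0 hp hm]].
  apply=> _ [i ->] /=; have hb := homog_sfb A i.
  by rewrite /uu omega_m_r //; split; rewrite row3E //; exact: homogZ.
have ha i : homog 0 ((qi q i * q ^+ 2) *: (w 0 im * sfa A i)).
  by apply: homogZ; exact: (homogMe hm (homog_sfa A i)).
have -> : w = \sum_i val (mkB (ha i)) *: uu i.
  apply: row3P; rewrite summxE.
  - by rewrite big1 // => i _; rewrite Omega1A_lE /uu omega_m_r ?row3E ?mulr0 //; exact: homog_sfb.
  - by rewrite big1 // => i _; rewrite Omega1A_lE /uu omega_m_r ?row3E ?mulr0 //; exact: homog_sfb.
  - rewrite -[LHS]mulr1 -(sum_sfa_sfb hq A) mulr_sumr; apply: eq_bigr => i _.
    rewrite Omega1A_lE /uu omega_m_r ?row3E /=; last exact: homog_sfb.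
    rewrite -scalerAl -!scalerAr scalerA -mulrA mulfV ?expf_neq0 // mulr1.
    by rewrite mulrA.
by apply: sub_set_sum => i; apply: sub_setl; apply: bspan_gen; exists i.
Qed.

End CalculusB.

Section Duality.
Variables (k : fieldType) (q : k) (hq : nonzero_not_root_of_unity q).
Variables (A : OqSL2 q) (C : calculus3D hq A).
Local Notation B := (OqS2 A).
Local Notation Omega1B := (Omega1B C).
Local Notation Omega2B := (Omega2B C).
Local Notation Gamma_p := (Gamma_p C).
Local Notation Gamma_m := (Gamma_m C).
Let q0 : q != 0. Proof. by case: hq. Qed.
Let qn0 n : q ^+ n != 0. Proof. by rewrite expf_neq0. Qed.

(* Components of a form in the decomposition Omega^1(B) = Gamma_+ (+) Gamma_-. *)
Lemma prp_subproof (w : Omega1B) : sub_set Gamma_p (row3 0 (val w 0 ip) 0).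
Proof. by apply/Gamma_pP; case: (Omega1BE w) => _ h _; split; rewrite row3E. Qed.
Definition prp (w : Omega1B) : Gamma_p := mk_sub (prp_subproof w).

Lemma prm_subproof (w : Omega1B) : sub_set Gamma_m (row3 0 0 (val w 0 im)).
Proof. by apply/Gamma_mP; case: (Omega1BE w) => _ _ h; split; rewrite row3E. Qed.
Definition prm (w : Omega1B) : Gamma_m := mk_sub (prm_subproof w).

Lemma pr_sum (w : Omega1B) : val w = val (prp w) + val (prm w).
Proof.
by case: (Omega1BE w) => h _ _; apply: row3P; rewrite mxE !row3E ?addr0 ?add0r.
Qed.

Lemma prpD u v : prp (u + v) = prp u + prp v.
Proof. by apply/val_inj/row3P; rewrite /= !mxE /= ?addr0. Qed.
Lemma prmD u v : prm (u + v) = prm u + prm v.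
Proof. by apply/val_inj/row3P; rewrite /= !mxE /= ?addr0. Qed.
Lemma prp_r u (b : B) : prp (u *< b) = prp u *< b.
Proof.
by apply/val_inj/row3P; rewrite /= !mxE /= ?sigma_B ?mul0r.
Qed.
Lemma prm_r u (b : B) : prm (u *< b) = prm u *< b.
Proof.
by apply/val_inj/row3P; rewrite /= !mxE /= ?sigma_B ?mul0r.
Qed.

(* The dual basis w_i^*(omega_+ y) = q_i b_i y; if omega_+ y = z omega_+
   with |y| = -2 then y = q^{-2} z. *)
Lemma wdual_homog i (w : Gamma_p) :
  homog 0 (qi q i *: (sfb A i * (q ^- 2 *: val w 0 ip))).
Proof.
have /Gamma_pP[_ h _] := sub_typeP w.
by apply/homogZ/(homogMe (homog_sfb A i) (homogZ _ h)).
Qed.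
Lemma wdual_subproof i : rlinear (fun w : Gamma_p => mkB (wdual_homog i w)).
Proof.
split=> [u v|u b]; apply: val_inj; rewrite /= !mxE.
  by rewrite scalerDr mulrDr scalerDr.
by rewrite sigma_B -!(scalerAl, scalerAr) mulrA.
Qed.
Definition wdual i : rdual Gamma_p := mk_rdual (wdual_subproof i).

Lemma ww_Gamma i : sub_set Gamma_p (ww C i).
Proof. by apply: bspan_gen; exists i. Qed.
Lemma wdualE i j : val (wdual i (mk_sub (ww_Gamma j))) = qi q i *: (sfb A i * sfa A j).
Proof.
rewrite /= /ww omega_p_r ?row3E; last exact: homog_sfa.
by rewrite scalerA mulVf // scale1r.
Qed.

(* The dual basis u_i^*(omega_- x) = a_i x; if omega_- x = z omega_-
   with |x| = 2 then x = q^2 z. *)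
Lemma udual_homog i (u : Gamma_m) : homog 0 (sfa A i * (q ^+ 2 *: val u 0 im)).
Proof.
have /Gamma_mP[_ _ h] := sub_typeP u.
exact: (homogMe (homog_sfa A i) (homogZ _ h)).
Qed.
Lemma udual_subproof i : rlinear (fun u : Gamma_m => mkB (udual_homog i u)).
Proof.
split=> [u v|u b]; apply: val_inj; rewrite /= !mxE.
  by rewrite scalerDr mulrDr.
by rewrite sigma_B -!(scalerAl, scalerAr) mulrA.
Qed.
Definition udual i : rdual Gamma_m := mk_rdual (udual_subproof i).

Lemma uu_Gamma i : sub_set Gamma_m (uu C i).
Proof. by apply: bspan_gen; exists i. Qed.
Lemma udualE i j : val (udual i (mk_sub (uu_Gamma j))) = sfa A i * sfb A j.
Proof.
rewrite /= /uu omega_m_r ?row3E; last exact: homog_sfb.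
by rewrite scalerA mulfV // scale1r.
Qed.

Definition Psi_p (w : Gamma_p) : rdual Gamma_m := \sum_i udual i *< wdual i w.
Definition Psi_m (u : Gamma_m) : rdual Gamma_p :=
  \sum_i ((qi q i)^-1)%:A *: (wdual i *< udual i u).

(* Psi_+ - q^2 Psi_-, where a pair (f, g) in Gamma_-^* (+) Gamma_+^* is seen
   as the element f o prm + g o prp of Omega^1(B)^*. *)
Lemma Psi_subproof (w : Omega1B) : rlinear (fun w' : Omega1B =>
  Psi_p (prp w) (prm w') - (q ^+ 2)%:A * Psi_m (prm w) (prp w')).
Proof.
split=> [u v|u b]; rewrite ?prpD ?prmD ?prp_r ?prm_r !(rdualD_eq, rdualM_eq).
  by rewrite mulrDr opprD addrACA.
by rewrite mulrBl mulrA.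
Qed.
Definition Psi (w : Omega1B) : rdual Omega1B := mk_rdual (Psi_subproof w).

(* The hom-connection *)

(* Omega^1(B)A, a right A-submodule of Omega^1(A) *)
Definition Omega1BA (w : Omega1A C) : Prop :=
  exists n (u : 'I_n -> Omega1B) (x : 'I_n -> A), w = \sum_i val (u i) *< x i.

(* g restricts to a right A-linear extension of f to Omega^1(B)A; the values
   of g outside Omega^1(B)A are irrelevant. *)
Definition rextension (f : rdual Omega1B) (g : Omega1A C -> A) : Prop :=
  [/\ forall u v, Omega1BA u -> Omega1BA v -> g (u + v) = g u + g v,
      forall u x, Omega1BA u -> g (u *< x) = g u * x
    & forall w : Omega1B, g (val w) = val (f w)].

Lemma rextension_sum f g n (u : 'I_n -> Omega1B) (x : 'I_n -> A) :
  rextension f g -> g (\sum_i val (u i) *< x i) = \sum_i val (f (u i)) * x i.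
Proof.
case=> gD gM gf.
have ex u' x' : Omega1BA (val (u' : Omega1B) *< x').
  by exists 1%N, (fun=> u'), (fun=> x'); rewrite big_ord1.
elim: n => [|n IH] in u x *.
  rewrite !big_ord0; have h : Omega1BA 0.
    by exists 0%N, (fun=> 0), (fun=> 0); rewrite big_ord0.
  by apply: (addrI (g 0)); rewrite -gD // !addr0.
pose w i := widen_ord (leqnSn n) i.
have ex' : Omega1BA (\sum_(i < n) val (u (w i)) *< x (w i)).
  by exists n, (u \o w), (x \o w).
rewrite !big_ord_recr /= (gD _ _ ex' (ex _ _)) (IH (u \o w) (x \o w)).
rewrite gM ?gf // -[val _]rscale1; exact: ex.
Qed.

Lemma rextension_unique f g g' :
  rextension f g -> rextension f g' -> forall w, Omega1BA w -> g w = g' w.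
Proof.
by move=> hg hg' w [n [u [x ->]]]; rewrite (rextension_sum _ _ hg) (rextension_sum _ _ hg').
Qed.

Lemma uu_Omega1B i : sub_set Omega1B (uu C i).
Proof.
apply/Omega1BP; have /Gamma_mP[h0 hp hm] := uu_Gamma i.
by split; rewrite ?hp //; exact: homog0.
Qed.
Lemma ww_Omega1B i : sub_set Omega1B (ww C i).
Proof.
apply/Omega1BP; have /Gamma_pP[h0 hp hm] := ww_Gamma i.
by split; rewrite ?hm //; exact: homog0.
Qed.
Definition uuB i : Omega1B := mk_sub (uu_Omega1B i).
Definition wwB i : Omega1B := mk_sub (ww_Omega1B i).

Lemma omega_m_sum : omega C im = \sum_i val (uuB i) *< sfa A i.
Proof.
rewrite /= /uu -[LHS]rscale1 -(sum_sfb_sfa hq A).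
transitivity (\sum_i omega C im *< (sfb A i * sfa A i)).
  apply: (big_morph (fun x => omega C im *< x)); first exact: rscaleDr.
  by apply: (addrI (omega C im *< 0)); rewrite -rscaleDr !addr0.
by apply: eq_bigr => i _; rewrite rscaleA.
Qed.

Lemma omega_p_sum :
  omega C ip = \sum_i val (wwB i) *< (qi q i *: sfb A i).
Proof.
rewrite /= /ww -[LHS]rscale1 -(sum_sfa_sfb hq A).
transitivity (\sum_i omega C ip *< (qi q i *: (sfa A i * sfb A i))).
  apply: (big_morph (fun x => omega C ip *< x)); first exact: rscaleDr.
  by apply: (addrI (omega C ip *< 0)); rewrite -rscaleDr !addr0.
by apply: eq_bigr => i _; rewrite -rscaleA scalerAr.
Qed.

Lemma rextension_exists (f : rdual Omega1B) : exists g, rextension f g.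
Proof.
have [tp [tpK tpK' tpM]] := sigma_inv C ip.
have [tm [tmK tmK' tmM]] := sigma_inv C im.
pose cm := \sum_i val (f (uuB i)) * sfa A i.
pose cp := \sum_i val (f (wwB i)) * (qi q i *: sfb A i).
exists (fun w => cm * tm (w 0 im) + cp * tp (w 0 ip)); split=> [u v _ _|u x _|w].
- by rewrite !mxE !linearD /= !mulrDr addrACA.
- by rewrite !mxE tmM tpM tmK tpK mulrDl !mulrA.
have [w0 hp hm] := Omega1BE w.
have etm : tm (val w 0 im) = q ^+ 2 *: val w 0 im.
  by rewrite -[RHS]tmK (sigma_p2 C (homogZ _ hm)).2 scalerA mulVf // scale1r.
have etp : tp (val w 0 ip) = q ^- 2 *: val w 0 ip.
  by rewrite -[RHS]tpK (sigma_n2 C (homogZ _ hp)).1 scalerA mulfV // scale1r.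
have hbm i : homog 0 (sfa A i * tm (val w 0 im)).
  by rewrite etm; exact: (homogMe (homog_sfa A i) (homogZ _ hm)).
have hbp i : homog 0 ((qi q i *: sfb A i) * tp (val w 0 ip)).
  by rewrite etp; exact: (homogMe (homogZ _ (homog_sfb A i)) (homogZ _ hp)).
have ew : w = (\sum_i uuB i *< mkB (hbm i)) + (\sum_i wwB i *< mkB (hbp i)).
  apply: val_inj; rewrite [RHS]/= !val_sub_sum.
  transitivity (omega C im *< tm (val w 0 im) + omega C ip *< tp (val w 0 ip)).
    rewrite etm etp omega_m_r ?omega_p_r; try exact: homogZ.
    rewrite !scalerA mulVf // mulfV // !scale1r.
    by apply: row3P; rewrite mxE !row3E ?addr0 ?add0r.
  rewrite {1}omega_m_sum {1}omega_p_sum !rscale_sum; congr (_ + _);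
    by apply: eq_bigr => i _; rewrite -rscaleA.
rewrite [in RHS]ew rdualD_eq !rdual_sum [RHS]/= !val_OqS2_sum /cm /cp !mulr_suml.
by congr (_ + _); apply: eq_bigr => i _; rewrite rdualM_eq /= mulrA.
Qed.

(* The unique (on Omega^1(B)A) right A-linear extension of f *)
Definition hat (f : rdual Omega1B) : Omega1A C -> A :=
  projT1 (cid (rextension_exists f)).

Lemma hatP f : rextension f (hat f).
Proof. exact: projT2 (cid (rextension_exists f)). Qed.

Lemma hat_m_homog f : homog (-2) (hat f (omega C im)).
Proof.
rewrite omega_m_sum (rextension_sum _ _ (hatP f)); apply: homog_sum => i.
by apply: (homogMe (OqS2_homog _) (homog_sfa A i)).
Qed.

Lemma hat_p_homog f : homog 2 (hat f (omega C ip)).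
Proof.
rewrite omega_p_sum (rextension_sum _ _ (hatP f)); apply: homog_sum => i.
by apply: (homogMe (OqS2_homog _) (homogZ _ (homog_sfb A i))).
Qed.

Lemma nabla_homog f : homog 0 (q ^- 2 *: partial C ip (hat f (omega C ip)) +
                               q ^+ 2 *: partial C im (hat f (omega C im))).
Proof.
apply: homogD; apply: homogZ.
  exact: (partial_homog C ip (hat_p_homog f)).
exact: (partial_homog C im (hat_m_homog f)).
Qed.
Definition nabla (f : rdual Omega1B) : B^o := mkB (nabla_homog f).

Lemma wedgeBD (w u v : Omega1B) : wedgeB w (u + v) = wedgeB w u + wedgeB w v.
Proof.
apply: val_inj; rewrite /= !(wedge_form (Omega1BE w)); try exact: Omega1BE.
  by apply: row3P; rewrite !mxE /= ?addr0 // !mulrDr scalerDr opprD addrACA.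
exact: (form1B_D (Omega1BE u) (Omega1BE v)).
Qed.

Lemma wedgeBDl (u v w : Omega1B) : wedgeB (u + v) w = wedgeB u w + wedgeB v w.
Proof.
apply: val_inj; rewrite /= !(fun h => wedge_form h (Omega1BE w)); try exact: Omega1BE.
  by apply: row3P; rewrite !mxE /= ?addr0 // !mulrDl scalerDr opprD addrACA.
exact: (form1B_D (Omega1BE u) (Omega1BE v)).
Qed.

Lemma wedgeB_r (w u : Omega1B) (b : B) : wedgeB w (u *< b) = wedgeB w u *< b.
Proof.
apply: val_inj; apply: row3P; rewrite Omega2A_rE sigma2_B !mxE /= !sigmaM !sigma_B;
by rewrite mulrBl -scalerAl !mulrA.
Qed.

Lemma wedgeB_m (u : Omega1B) (b : B) (w : Omega1B) : wedgeB (u *< b) w = wedgeB u (b *: w).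
Proof.
by apply: val_inj; apply: row3P; rewrite !mxE /= !sigmaM !sigma_B !mulrA.
Qed.

(* (f omega)(omega') = f(omega omega') *)
Lemma rdual_form_subproof (f : rdual Omega2B) (w : Omega1B) :
  rlinear (fun w' => f (wedgeB w w')).
Proof.
by split=> [u v|u b]; rewrite ?wedgeBD ?wedgeB_r ?rdualD_eq ?rdualM_eq.
Qed.
Definition rdual_form f w : rdual Omega1B := mk_rdual (rdual_form_subproof f w).

Lemma hat_mE f : hat f (omega C im) = \sum_i val (f (uuB i)) * sfa A i.
Proof. by rewrite omega_m_sum (rextension_sum _ _ (hatP f)). Qed.
Lemma hat_pE f : hat f (omega C ip) = \sum_i val (f (wwB i)) * (qi q i *: sfb A i).
Proof. by rewrite omega_p_sum (rextension_sum _ _ (hatP f)). Qed.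

Lemma omega_Omega1BA : Omega1BA (omega C ip) /\ Omega1BA (omega C im).
Proof.
split; first by rewrite omega_p_sum; exists 3%N, wwB, (fun i => qi q i *: sfb A i).
by rewrite omega_m_sum; exists 3%N, uuB, (sfa A).
Qed.

Lemma omega_B i (b : B) : val b *: omega C i = omega C i *< val b.
Proof.
apply/rowP => j; rewrite Omega1A_lE Omega1A_rE sigma_B omegaE.
by case: (j == i); rewrite ?mulr1 ?mul1r ?mulr0 ?mul0r.
Qed.

Lemma hat_r (f : rdual Omega1B) (b : B) :
  (hat (f *< b) (omega C ip) = hat f (omega C ip) * val b) *
  (hat (f *< b) (omega C im) = hat f (omega C im) * val b).
Proof.
have [hp hm] := omega_Omega1BA; have [_ hM _] := hatP f.
split; rewrite -hM // -omega_B.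
  rewrite hat_pE -(rextension_sum (fun i => b *: wwB i) _ (hatP f)).
  rewrite omega_p_sum scaler_sumr; congr (hat f _).
  by apply: eq_bigr => i _; rewrite scale_rscale.
rewrite hat_mE -(rextension_sum (fun i => b *: uuB i) _ (hatP f)).
rewrite omega_m_sum scaler_sumr; congr (hat f _).
by apply: eq_bigr => i _; rewrite scale_rscale.
Qed.

Lemma Omega1BA_r w x : Omega1BA w -> Omega1BA (w *< x).
Proof.
move=> [n [u [y ->]]]; exists n, u, (fun i => y i * x).
by rewrite rscale_sum; apply: eq_bigr => i _; rewrite rscaleA.
Qed.

Lemma hat_form (f : rdual Omega1B) (w : Omega1B) :
  val (f w) = hat f (omega C ip) * (q ^- 2 *: val w 0 ip) +
              hat f (omega C im) * (q ^+ 2 *: val w 0 im).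
Proof.
have [hp hm] := omega_Omega1BA; have [hD hM hf] := hatP f.
rewrite -!hM // -hD; try exact: Omega1BA_r.
rewrite -hf; congr (hat f _); have [w0 hwp hwm] := Omega1BE w.
rewrite omega_p_r ?omega_m_r; try exact: homogZ.
rewrite !scalerA mulfV // mulVf // !scale1r.
by apply: row3P; rewrite mxE !row3E ?addr0 ?add0r.
Qed.

Lemma nablaD (f g : rdual Omega1B) : nabla (f + g) = nabla f + nabla g.
Proof.
apply: val_inj; rewrite /= !hat_mE !hat_pE.
have e (u : 'I_3 -> Omega1B) (x : 'I_3 -> A) :
    \sum_i val ((f + g : rdual _) (u i)) * x i =
    \sum_i val (f (u i)) * x i + \sum_i val (g (u i)) * x i.
  by rewrite -big_split; apply: eq_bigr => i _; rewrite rdual_addE /= mulrDl.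
by rewrite !e !linearD /= ?scalerDr addrACA.
Qed.

(* The hom-connection property *)
Lemma nablaM (f : rdual Omega1B) (b : B) :
  nabla (f *< b) = nabla f * b + f (dB0 C b).
Proof.
apply: val_inj; rewrite /= hat_form !hat_r !partialM !sigma_B !mxE.
by rewrite !scalerDr mulrDl -!scalerAl -!scalerAr addrACA.
Qed.

Lemma dB1D (u v : Omega1B) : dB1 (u + v) = dB1 u + dB1 v.
Proof.
apply: val_inj; rewrite /= !dA1_form; try exact: Omega1BE.
  by apply: row3P; rewrite !mxE /= ?addr0 // !linearD /= ?scalerDr ?opprD addrACA.
exact: (form1B_D (Omega1BE u) (Omega1BE v)).
Qed.

Lemma dB1M (w : Omega1B) (b : B) :
  dB1 (w *< b) = dB1 w *< b - wedgeB w (dB0 C b).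
Proof.
have hw := Omega1BE w; have hb := form1B_dA0 C b.
apply: val_inj; rewrite /= wedge_form // !dA1_form //; last exact: form1B_r.
apply: row3P; rewrite !mxE /= ?mul0r ?subr0 // !sigma_B sigma2_B !partialM !sigma_B.
rewrite mulrBl scalerDr opprD opprB -scalerAl addrACA; congr (_ + _).
Qed.

Lemma nabla1_subproof (f : rdual Omega2B) :
  rlinear (fun w => nabla (rdual_form f w) + f (dB1 w)).
Proof.
split=> [u v|u b].
  rewrite (_ : rdual_form f (u + v) = rdual_form f u + rdual_form f v).
    by rewrite nablaD dB1D rdualD_eq addrACA.
  apply: rdual_ext => w; rewrite rdual_addE /rdual_form /rdual_fun /=.
  by rewrite wedgeBDl; exact: rdualD_eq.
rewrite (_ : rdual_form f (u *< b) = rdual_form f u *< b); last first.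
  by apply: rdual_ext => w; rewrite rdual_rE /rdual_fun /= wedgeB_m.
rewrite nablaM dB1M rdualD_eq rdualM_eq.
have fN v : f (- v) = - f v.
  have f0 : f 0 = 0 by apply: (addrI (f 0)); rewrite -rdualD_eq !addr0.
  by apply: (addrI (f v)); rewrite -rdualD_eq !subrr f0.
by rewrite fN mulrDl addrACA subrr addr0.
Qed.
Definition nabla1 (f : rdual Omega2B) : rdual Omega1B :=
  mk_rdual (nabla1_subproof f).

End Duality.

Arguments omega_mp {k q hq A} C.
Arguments phi {k q hq A} C.
Arguments dB0 {k q hq A} C b.
Arguments dB1 {k q hq A} C w.
Arguments Theta {k q hq A} C b.
Arguments Theta_star {k q hq A} C b.
Arguments Psi {k q hq A} C w.
Arguments nabla {k q hq A} C f.
Arguments nabla1 {k q hq A} C f.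

(* Main.v *)
Require Import Defs.
From mathcomp Require Import all_boot all_order all_algebra.
From mathcomp Require Import ring.

Set Implicit Arguments.
Unset Strict Implicit.
Unset Printing Implicit Defensive.

Import GRing.Theory.
Local Open Scope ring_scope.

(** Two-forms on the quantum sphere are the multiples [b omega_- omega_+] of a
    central volume form, and [phi] reads off the coefficient [b].  The proof
    rests on recognising [Psi] as the Hodge-type pairing given by the product
    of one-forms: [Psi w w' = - phi (w w')] ([Psi_wedge]).  Evaluating the
    defining sums of [Psi_+] and [Psi_-] with the two partitions of unity
    [\sum_i b_i a_i = \sum_i q_i a_i b_i = 1] gives this at once.

    Feeding this into the formula for the hom-connection yields
    [nabla (Psi w) = phi (d w)] ([nabla_Psi]), which is the right-hand square,
    since [Theta] is inverse to [phi].  The left-hand square then reads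
    [- phi ((d b) w) = - phi (d (b w)) + phi (b (d w))], that is, the Leibniz rule
    for the product of a function and a one-form ([dB1_lM]).

    [Theta] and [Theta_star] are bijective because the volume form is a central
    basis.  [Psi] is bijective because a functional [f] on one-forms is
    determined by the two values of its extension [hat f] on [omega_+] and
    [omega_-], and up to sign and powers of [q] these are the coefficients
    of the one-form [w] with [Psi w = f].

    Finally [d (d b) = 0] comes from the identity
    [partial_- partial_+ - q^2 partial_+ partial_- = - q partial_0] on all of
    [O_q(SL(2))] ([partial_comm]), whose right-hand side vanishes in degree
    zero.  Everything that the bottom row must satisfy to be a complex is
    transported along the isomorphisms ([complex_transport]). *)

(** * Transport of complexes along isomorphisms *)

Lemma bimod_iso_inv (R : nzRingType) (M N : bimodType R) (f : M -> N) :
  bimod_iso f -> exists2 g, bimod_iso g & cancel f g /\ cancel g f.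
Proof.
move=> [[fD fZ fR] [g fK gK]]; exists g => //.
split; last by exists f.
by split=> *; apply: (can_inj fK); rewrite ?(fD, fZ, fR) !gK.
Qed.

Lemma complex_transport (k : nzRingType) (R : algType k)
    (M0 M1 M2 N0 N1 N2 : bimodType R)
    (d0 : M0 -> M1) (d1 : M1 -> M2) (e0 : N0 -> N1) (e1 : N1 -> N2)
    (f0 : M0 -> N0) (f1 : M1 -> N1) (f2 : M2 -> N2) :
  is_complex d0 d1 -> bimod_iso f0 -> bimod_iso f1 -> bimod_iso f2 ->
  (forall u, f1 (d0 u) = e0 (f0 u)) -> (forall u, f2 (d1 u) = e1 (f1 u)) ->
  complexes_isomorphic d0 d1 e0 e1.
Proof.
move=> dP f0P f1P f2P fd0 fd1; split=> //; last by exists f0, f1, f2.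
have [d0L d1L dd] := dP.
have [[f0D f0Z _] [g0 _ g0K]] := f0P.
have [[f1D f1Z _] [g1 _ g1K]] := f1P.
have [[f2D f2Z _] _] := f2P.
split=> [c u v|c u v|u].
- by rewrite -[u]g0K -[v]g0K -f0Z -f0D -!fd0 d0L f1D f1Z.
- by rewrite -[u]g1K -[v]g1K -f1Z -f1D -!fd1 d1L f2D f2Z.
rewrite -[u]g0K -fd0 -fd1 dd.
by apply: (addrI (f2 0)); rewrite -f2D !addr0.
Qed.

Section QuantumSphere.
Variables (k : fieldType) (q : k) (hq : nonzero_not_root_of_unity q).
Variables (A : OqSL2 q) (C : calculus3D hq A).
Local Notation B := (OqS2 A).

Let q0 : q != 0. Proof. by case: hq. Qed.
Let qn0 n : q ^+ n != 0. Proof. by rewrite expf_neq0. Qed.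

(** * The de Rham complex *)

(** The coefficient of [omega_- omega_+] in [d^2 = 0] on [A].  It passes to
    products because the mixed terms cancel: [partial_+] and [partial_-] shift
    degrees by [-2] and [2], so each commutes with [sigma] up to [q^2] or
    [q^-2], exactly offsetting the factor [q^2]. *)
Lemma partial_comm n (x : A) : homog n x ->
  partial C im (partial C ip x) - q ^+ 2 *: partial C ip (partial C im x) =
  - q *: partial C i0 x.
Proof.
have [a0 b0 c0 d0] := partial0_gen C.
have [ap bp cp dp] := partialp_gen C.
have [am bm cm dm] := partialm_gen C.
have e : - q * - q ^+ 2 = - (q ^+ 2 * - q) by ring.
elim=> {n x}.
- by move=> n; rewrite !linear0 addr0.
- by rewrite !partial_1 !linear0 addr0.
- by rewrite ap am a0 linear0 linearZ /= bm scaler0 subr0.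
- by rewrite bp bm b0 linear0 ap !scalerA e sub0r scaleNr.
- by rewrite cp cm c0 linear0 linearZ /= dm scaler0 subr0.
- by rewrite dp dm d0 linear0 cp !scalerA e sub0r scaleNr.
- move=> n x y _ IHx _ IHy.
  by rewrite !linearD /= -IHx -IHy addrACA.
- move=> n c x _ IHx; rewrite !linearZ /= -IHx scalerBr.
  by rewrite !scalerN !scalerA mulrC.
move=> m n x y hx IHx hy IHy.
have syp : sigma C ip y = q ^ (- n) *: y.
  by rewrite (sigma_homog C _ hy) /sigma_weight /= mul1r.
have sym : sigma C im y = q ^ (- n) *: y.
  by rewrite (sigma_homog C _ hy) /sigma_weight /= mul1r.
have sy0 : sigma C i0 y = (q ^ (- n) * q ^ (- n)) *: y.
  rewrite (sigma_homog C _ hy) /sigma_weight /= -expfzDr //.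
  by congr (q ^ _ *: _); ring.
have spy : sigma C im (partial C ip y) = (q ^+ 2 * q ^ (- n)) *: partial C ip y.
  rewrite (sigma_homog C _ (partial_homog C ip hy)) exprnP -expfzDr //.
  by congr (q ^ _ *: _); rewrite /sigma_weight /partial_shift /=; ring.
have smy : sigma C ip (partial C im y) = (q ^- 2 * q ^ (- n)) *: partial C im y.
  rewrite (sigma_homog C _ (partial_homog C im hy)) exprnP invr_expz -expfzDr //.
  by congr (q ^ _ *: _); rewrite /sigma_weight /partial_shift /=; ring.
rewrite !partialM !linearD /= !partialM spy smy syp sym sy0.
rewrite !linearZ /= ?syp ?sym -!(scalerAl, scalerAr).
set t := q ^ (- n).
rewrite [in RHS]scalerA [- q * _]mulrC -[in RHS]scalerA.
rewrite [_ *: (partial C i0 x * y)]scalerAl [_ *: (x * partial C i0 y)]scalerAr.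
rewrite -IHx -IHy mulrBl mulrBr -!(scalerAl, scalerAr).
rewrite !(scalerN, scalerDr, opprD, scalerA, addrA).
rewrite (_ : q ^+ 2 * (q ^- 2 * t) = t); last by rewrite mulrA mulfV // mul1r.
rewrite (_ : q ^+ 2 * (t * t) = t * t * q ^+ 2); last by ring.
(* The last two pairs are the mixed terms. *)
rewrite (ACl (1 * 5 * 4 * 8 * (2 * 7) * (3 * 6))) /=.
by rewrite !subrr !addr0.
Qed.

Lemma dB1_dB0 (b : B) : dB1 C (dB0 C b) = 0.
Proof.
have hb := OqS2_homog b.
apply: val_inj; rewrite /= dA1_form ?mxE; last exact: form1B_dA0.
rewrite (partial_comm hb) (partial0_homog C hb) mulr0 oppr0 expr0z.
rewrite subrr mulr0 mul0r scale0r scaler0.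
by apply: row3P; rewrite row3E mxE.
Qed.

(** Left Leibniz rule: the commutativity of the left-hand square is this
    identity read through the pairing [Psi]. *)
Lemma dB1_lM (b : B) (w : Omega1B C) :
  dB1 C (b *: w) = wedgeB (dB0 C b) w + b *: dB1 C w.
Proof.
have hw := Omega1BE w; have hb := form1B_dA0 C b; have [_ wp wm] := hw.
apply: val_inj; rewrite /= wedge_form // !dA1_form //; last exact: form1B_l.
apply: row3P; rewrite !mxE /= ?mulr0 ?addr0 //.
rewrite !partialM (sigma_n2 C wp) (sigma_p2 C wm) -!scalerAr.
rewrite scalerDr scalerA mulfV // scale1r mulrBr -scalerAr opprD.
by rewrite addrACA.
Qed.

Lemma dB0_klinear : klinear (dB0 C).
Proof.
move=> c u v; apply: val_inj; apply/rowP => i.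
by rewrite !mxE /= linearD /= -!scalerAl !mul1r linearZ.
Qed.

Lemma dB1_klinear : klinear (dB1 C).
Proof.
(* Scalars are closed, so the Leibniz rule reduces to linearity. *)
move=> c u v; rewrite dB1D dB1_lM (_ : wedgeB _ u = 0) ?add0r //.
apply: val_inj; rewrite /= wedge_form; [|exact: (form1B_dA0 C c%:A)|exact: Omega1BE].
apply: row3P; rewrite !mxE //= !linearZ /= !partial_1.
by rewrite !scaler0 !mul0r scaler0 subrr.
Qed.

Lemma val_OqS2D (x y : B) : val (x + y) = val x + val y. Proof. by []. Qed.
Lemma val_OqS2M (x y : B) : val (x * y) = val x * val y. Proof. by []. Qed.

(** * The pairing [Psi] and the two squares *)

Lemma rdual_sumE (R : nzRingType) (M : bimodType R) n (f : 'I_n -> rdual M) u :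
  (\sum_i f i : rdual M) u = \sum_i f i u.
Proof. exact: (big_morph (fun g : rdual M => g u)). Qed.

Lemma Psi_pE (w : Gamma_p C) (u : Gamma_m C) :
  val (Psi_p w u) = val w 0 ip * val u 0 im.
Proof.
rewrite /Psi_p rdual_sumE val_OqS2_sum.
rewrite -[in RHS](mul1r (val w 0 ip)) -(sum_sfa_sfb hq A) !mulr_suml.
apply: eq_bigr => i _; rewrite /= mxE /= -!(scalerAl, scalerAr) !scalerA.
by rewrite mulrAC mulfV // mul1r !mulrA.
Qed.

Lemma Psi_mE (u : Gamma_m C) (w : Gamma_p C) :
  val (Psi_m u w) = val u 0 im * val w 0 ip.
Proof.
rewrite /Psi_m rdual_sumE val_OqS2_sum.
rewrite -[in RHS](mul1r (val u 0 im)) -(sum_sfb_sfa hq A) !mulr_suml.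
apply: eq_bigr => i _; rewrite /= mxE /= -!(scalerAl, scalerAr) !scalerA mul1r.
by rewrite mulfVK // mulVf ?qi_neq0 // scale1r !mulrA.
Qed.

Lemma PsiE (w w' : Omega1B C) :
  val (Psi C w w') = val w 0 ip * val w' 0 im - q ^+ 2 *: (val w 0 im * val w' 0 ip).
Proof. by rewrite /= Psi_pE Psi_mE !row3E -!scalerAl mul1r. Qed.

(** The sign comes from [omega_+ omega_- = - q^2 omega_- omega_+]: the
    coefficient of [y omega_+ x' omega_-] in the product is [- y x']. *)
Lemma Psi_wedge (w w' : Omega1B C) : Psi C w w' = - phi C (wedgeB w w').
Proof.
apply: val_inj; rewrite PsiE /= wedge_form; try exact: Omega1BE.
by rewrite !row3E opprB.
Qed.

Lemma Psi_bimod_morphism : bimod_morphism (Psi C).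
Proof.
split=> [u v|b u|u b]; apply: rdual_ext => w.
- apply: val_inj; rewrite rdual_addE [RHS]val_OqS2D !PsiE !mxE !mulrDl scalerDr opprD.
  by rewrite addrACA.
- apply: val_inj; rewrite rdual_lE [RHS]val_OqS2M !PsiE !mxE mulrBr.
  by rewrite -scalerAr !mulrA.
- apply: val_inj; rewrite rdual_rE !PsiE !mxE !sigma_B.
  by rewrite !mulrA.
Qed.

(** The values of [Psi w] on the generators [omega_- b_i] and [omega_+ a_i] are
    products with [b_i] and [a_i], which the partitions of unity remove.  This
    shows that [Psi] is injective and tells how to invert it. *)
Lemma hat_Psi (w : Omega1B C) :
  hat (Psi C w) (omega C ip) = - q ^+ 4 *: val w 0 im /\
  hat (Psi C w) (omega C im) = q ^- 2 *: val w 0 ip.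
Proof.
split; rewrite ?hat_pE ?hat_mE.
  rewrite -[in RHS](mulr1 (val w 0 im)) -(sum_sfa_sfb hq A) mulr_sumr scaler_sumr.
  apply: eq_bigr => i _; rewrite PsiE /= /ww omega_p_r ?row3E; last exact: homog_sfa.
  rewrite mulr0 sub0r -!(scalerAl, scalerAr) mulNr -!(scalerAl, scalerAr).
  by rewrite scalerN !scalerA !mulrA -scaleNr; congr (_ *: _); ring.
rewrite -[in RHS](mulr1 (val w 0 ip)) -(sum_sfb_sfa hq A) mulr_sumr scaler_sumr.
apply: eq_bigr => i _; rewrite PsiE /= /uu omega_m_r ?row3E; last exact: homog_sfb.
by rewrite mulr0 scaler0 subr0 -!(scalerAl, scalerAr) mulrA.
Qed.

Lemma Psi_inv_subproof (f : rdual (Omega1B C)) :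
  sub_set (Omega1B C) (row3 0 (q ^+ 2 *: hat f (omega C im))
                              (- q ^- 4 *: hat f (omega C ip))).
Proof.
apply/Omega1BP/form1B_row3; apply: homogZ.
  exact: hat_m_homog.
exact: hat_p_homog.
Qed.

Lemma Psi_iso : bimod_iso (Psi C).
Proof.
split; first exact: Psi_bimod_morphism.
exists (fun f => mk_sub (Psi_inv_subproof f)) => [w|f].
  have [hp hm] := hat_Psi w; have [w0 _ _] := Omega1BE w.
  apply: val_inj; apply: row3P; rewrite row3E // ?hp ?hm scalerA.
    by rewrite mulfV // scale1r.
  by rewrite mulrNN mulVf // scale1r.
apply: rdual_ext => w; apply: val_inj.
rewrite PsiE hat_form !row3E -!(scalerAl, scalerAr) scalerA addrC.
by rewrite mulrN scaleNr opprK; congr (_ *: _ + _); field.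
Qed.

Lemma Theta_iso : bimod_iso (Theta C).
Proof.
split; last first.
  exists (phi C) => [b|v].
    by rewrite /Theta rdualM_eq phi_mp mul1r.
  have [_ vp vm] := Omega2BE v.
  apply: val_inj; rewrite /= wedge_mp.
  apply: row3P; rewrite Omega2A_rE row3E ?mul0r //.
  by rewrite mul1r (sigma2_B C i0 (phi C v)).
split=> [u v|b u|u b]; first exact: rscaleDr; last exact: rscaleA.
apply: val_inj; rewrite /= wedge_mp.
apply: row3P; rewrite !mxE /= ?mul0r ?mulr0 // !mul1r.
by rewrite (sigma2_B C i0 (b * u)) (sigma2_B C i0 u).
Qed.

Lemma phi_l (b : B) v : phi C (b *: v) = b * phi C v.
Proof. by apply: val_inj; rewrite /= mxE. Qed.

Lemma Theta_star_iso : bimod_iso (Theta_star C).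
Proof.
split; last first.
  exists (fun f : rdual (Omega2B C) => f (omega_mp C)) => [b|f].
    by rewrite /Theta_star rdual_rE phi_l phi_mp mulr1.
  apply: rdual_ext => v; rewrite /Theta_star rdual_rE phi_l -rdualM_eq.
  congr (f _); have [_ [g _ gK]] := Theta_iso.
  by rewrite -[v]gK /Theta rdualM_eq phi_mp mul1r.
split=> [u v|b u|u b]; first exact: rscaleDr; last exact: rscaleA.
by apply: rdual_ext => v; rewrite rdual_lE /Theta_star !rdual_rE !phi_l mulrA.
Qed.

Lemma nabla_Psi (w : Omega1B C) : nabla C (Psi C w) = phi C (dB1 C w).
Proof.
have [hp hm] := hat_Psi w.
apply: val_inj; rewrite /= hp hm dA1_form ?row3E; last exact: Omega1BE.
rewrite !linearZ /= !scalerA mulVf // scale1r addrC scalerN -scaleNr.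
by congr (_ + _ *: _); field.
Qed.

Lemma Theta_nabla_Psi (w : Omega1B C) : dB1 C w = Theta C (nabla C (Psi C w)).
Proof.
rewrite nabla_Psi; have [_ [g _ gK]] := Theta_iso.
by rewrite -[dB1 C w]gK /Theta rdualM_eq phi_mp mul1r.
Qed.

Lemma nablaN (f : rdual (Omega1B C)) : nabla C (- f) = - nabla C f.
Proof.
have nabla0 : nabla C 0 = 0.
  by apply: (addrI (nabla C 0)); rewrite -nablaD !addr0.
by apply: (addrI (nabla C f)); rewrite -nablaD !subrr.
Qed.

Lemma Psi_dB0 (b : B) : Psi C (dB0 C b) = nabla1 C (Theta_star C b).
Proof.
apply: rdual_ext => w; rewrite Psi_wedge.
transitivity (nabla C (rdual_form (Theta_star C b) w) + Theta_star C b (dB1 C w));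
  last by [].
have -> : rdual_form (Theta_star C b) w = - Psi C (b *: w).
  apply: rdual_ext => w'.
  transitivity (- (Psi C (b *: w) w')); last by [].
  rewrite Psi_wedge opprK; congr (phi C _).
  apply: val_inj; apply: row3P; rewrite !mxE /=;
    by rewrite mulrBr !mulrA -scalerAr !mulrA.
by rewrite nablaN nabla_Psi /Theta_star rdual_rE dB1_lM rdualD_eq opprD subrK.
Qed.

Lemma de_Rham_is_complex : is_complex (dB0 C) (dB1 C).
Proof. by split; [exact: dB0_klinear | exact: dB1_klinear | exact: dB1_dB0]. Qed.

End QuantumSphere.

Theorem proposition4p5 (k : fieldType) (char0 : [pchar k] =i pred0)
    (q : k) (hq : nonzero_not_root_of_unity q)
    (A : OqSL2 q) (C : calculus3D hq A) :
  [/\ (forall b, Psi C (dB0 C b) = nabla1 C (Theta_star C b)),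
      (forall w, dB1 C w = Theta C (nabla C (Psi C w))),
      bimod_iso (Theta_star C),
      bimod_iso (Psi C)
    & bimod_iso (Theta C)] /\
  complexes_isomorphic (dB0 C) (dB1 C) (nabla1 C) (nabla C).
Proof.
split.
  split; [exact: Psi_dB0 | exact: Theta_nabla_Psi | exact: Theta_star_iso
         | exact: Psi_iso | exact: Theta_iso].
have [phi_ phi_iso [phiK _]] := bimod_iso_inv (Theta_iso C).
apply: (complex_transport (de_Rham_is_complex C) (Theta_star_iso C) (Psi_iso C)
         phi_iso (Psi_dB0 C)) => w.
by rewrite Theta_nabla_Psi phiK.
Qed.
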